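(* Let $P_1,P_2\in\mathbb{C}[X]$ be nonzero, non-proportional polynomials vanishing at $0$, with multiplicities $\nu_1\ge\nu_2=\nu\ge 1$ at $0$, and let $f_\lambda(z)=Q_\lambda(P_1(z),P_2(z))$, $\lambda\in\mathbb{C}^m$, be the lacunary family described in the context, with $m\ge 2$. Assume that $B_1=1$, where $B_1$ is the supremum, over $|z|\le 1$ and over the $m$ monomials $X^{t_{\ell,i}-1}Y^{n_\ell-(t_{\ell,i}-1)}$ occurring in $Q_\lambda$, of $|P_1(z)^{t_{\ell,i}-1}P_2(z)^{n_\ell-(t_{\ell,i}-1)}|$. Assume that at least one of the following lacunarity conditions holds: - $\nu n_{\ell+1}>n_\ell D$ for all $0\le \ell\le \ell_d-1$; - $\nu_1=\nu_2$ and $\nu n_{\ell+1}>\nu n_\ell+(k+1)(\tau_\ell-1)$ for all $0\le\ell\le\ell_d-1$; - $\nu_1\ne\nu_2$ and $\bar\nu_{\ell+1}>\widetilde\nu_\ell$ for all $0\le\ell\le\ell_d-1$; - $\nu_1=\nu_2$ and for all $\ell,\ell'\in\{0,\dots,\ell_d\}$: if $\ell>\ell'$ and $\bar\nu_\ell\equiv\bar\nu_{\ell'}\pmod{k+1}$ then $\bar\nu_\ell>\bar\nu_{\ell'}+(k+1)(\tau_{\ell'}-1)$; - $\nu_1\neq\nu_2$ and for all $\ell,\ell'\in\{0,\dots,\ell_d\}$: if $\ell>\ell'$ and $\bar\nu_\ell\equiv\bar\nu_{\ell'}\pmod{|\nu_1-\nu_2|}$ then $\bar\nu_\ell>\widetilde\nu_{\ell'}$.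 Let $\mathcal{Z}(f_\lambda)$ be the maximum, over $\lambda\in\mathbb{C}^m$ with $f_\lambda\not\equiv 0$, of the number of zeros (counted with multiplicity) of $f_\lambda$ in the closed disc $\bar D_{1/4}$. Then: (1) If $\nu_1\ne\nu_2$, then $$\mathcal{Z}(f_\lambda)\le 5(\widetilde\nu_{\ell_e}+1)\log 2+\frac52(m+1)\log m+5(\bar t-m)\log\left(\frac1{|\alpha_0|}\right)+5\bigl(\overline{\tau n}-(\bar t-m)\bigr)\log\left(\frac1{|a_0|}\right)=O(dm).$$ Moreover, for $\lambda\ne 0$, the maximal number of zeros of $f_\lambda$ in $\bar D_\rho$ is at most $\widetilde\nu_{\ell_e}$, where $$\rho=\frac{3}{4\cdot 8^{\widetilde\nu_{\ell_e}}}\cdot\frac{|\alpha_0|^{\bar t-m}|a_0|^{\overline{\tau n}-(\bar t-m)}}{m^{\frac{m+1}2}}.$$ (2) If $\nu_1=\nu_2$, then $$\mathcal{Z}(f_\lambda)\le 5\bigl(\bar\nu_{\ell_e}+(k+1)(\tau_{\ell_e}-1)\bigr)\log 2+5\log\left(2+\frac{4m^{\frac{m+1}2}}{3\bar C\,|\mu|^{\bar t-\bar\tau}|a_0|^{\overline{\tau n}-\bar\tau'}|\bar\delta_k|^{\bar\tau'}}\right)=O(dm).$$ Moreover, for $\lambda\ne0$, the maximal number of zeros of $f_\lambda$ in $\bar D_\rho$ is at most $\nu n_{\ell_e}$, where $$\rho=\frac{3}{4\cdot 8^{\nu n_{\ell_e}+(k+1)(\tau_{\ell_e}-1)}}\min\left\{\frac23,\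 \frac{\bar C\,|\mu|^{\bar t-\bar\tau}|a_0|^{\overline{\tau n}-\bar\tau'}|\bar\delta_k|^{\bar\tau'}}{m^{\frac{m+1}2}}\right\}.$$
   Context: For $\rho>0$, $\bar D_\rho=\{z\in\mathbb{C}:|z|\le\rho\}$. Zeros are counted with multiplicity. Curve. $D_i=\deg P_i\ge 1$, $D=\max(D_1,D_2)$. Write $P_1(X)=X^{\nu_1}\sum_{i=0}^{D_1-\nu_1}\alpha_iX^i$, $P_2(X)=X^{\nu_2}\sum_{i=0}^{D_2-\nu_2}a_iX^i$ with $\alpha_0,a_0\ne0$; coefficients with index beyond the degree are $0$. By convention (up to permuting the variables) $\nu_1\ge\nu_2$, and $\nu=\nu_2$. Lacunary family. Integers $0\le n_0<n_1<\dots<n_{\ell_d}=d$ are given, and for each $\ell\in\{0,\dots,\ell_d\}$ a nonempty set $T_\ell=\{t_{\ell,1}<\dots<t_{\ell,\tau_\ell}\}\subset\{1,\dots,n_\ell+1\}$. Set $m=\sum_{\ell=0}^{\ell_d}\tau_\ell$ and, for $\lambda=(\lambda_{\ell,i})\in\mathbb{C}^m$, $$Q_\lambda(X,Y)=\sum_{\ell=0}^{\ell_d}\sum_{i=1}^{\tau_\ell}\lambda_{\ell,i}X^{t_{\ell,i}-1}Y^{n_\ell-(t_{\ell,i}-1)},\qquad f_\lambda(z)=Q_\lambda(P_1(z),P_2(z)).$$ Notation. For each $\ell$: $\bar\nu_\ell=(t_{\ell,1}-1)\nu_1+(n_\ell-(t_{\ell,1}-1))\nu_2$ and $\widetilde\nu_\ell=(t_{\ell,\tau_\ell}-1)\nu_1+(n_\ell-(t_{\ell,\tau_\ell}-1))\nu_2$.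 If $\nu_1=\nu_2$: $\mu=\alpha_0/a_0$; $k\ge 0$ is the largest integer such that $(\alpha_0,\dots,\alpha_k)=\mu\cdot(a_0,\dots,a_k)$; $\bar\delta_k=\alpha_{k+1}-\mu a_{k+1}$; $\ell_e$ is the index $\ell$ maximizing $\bar\nu_\ell+(k+1)\tau_\ell$. If $\nu_1\ne\nu_2$: $\ell_e$ is the index $\ell$ maximizing $\widetilde\nu_\ell$. $\bar t=\sum_{\ell}\sum_{i=1}^{\tau_\ell}t_{\ell,i}$, $\overline{\tau n}=\sum_\ell\tau_\ell n_\ell$, $\bar\tau=\sum_\ell\frac{\tau_\ell(\tau_\ell+1)}2$, $\bar\tau'=\sum_\ell\frac{\tau_\ell(\tau_\ell-1)}2$, and $$\bar C=\prod_{\ell=0}^{\ell_d}C_\ell,\qquad C_\ell=\prod_{i=1}^{\tau_\ell}\frac{\prod_{j<i}(t_{\ell,i}-t_{\ell,j})}{(i-1)!}.$$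
   Formalization: In the last sentence of (2) the bound ν n_{ℓ_e} is replaced by ν n_{ℓ_e}+(k+1)(τ_{ℓ_e}−1); as printed it fails whenever τ_{ℓ_e}≥2, e.g. P₁=z, P₂=z(z+1)/2, n₀=1, T₀={1,2}, where 2P₂−P₁=z² has 2>1 zeros at 0. *)

(* Defs.v *)
From mathcomp Require Import all_boot all_order all_algebra.
From mathcomp Require Import complex.
From mathcomp Require Import all_classical all_reals all_analysis.

Set Implicit Arguments.
Unset Strict Implicit.
Unset Printing Implicit Defensive.
Import Order.TTheory GRing.Theory Num.Theory.

Local Open Scope classical_set_scope.
Local Open Scope ring_scope.

(* Real-valued modulus: the generic norm on R[i] takes its values in R[i]. *)
Notation cabs := ComplexField.Normc.normc.

(* Exponents of the lacunary family.  Only the indices l <= ld are relevant;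
   T_ l lists its l-th set in increasing order. *)
Record lacunary := Lacunary {
  ld : nat;
  n_ : nat -> nat;
  T_ : nat -> seq nat;
  n_incr : forall l, (l < ld)%N -> (n_ l < n_ l.+1)%N;
  T_neq0 : forall l, (l <= ld)%N -> T_ l != [::];
  T_sorted : forall l, (l <= ld)%N -> sorted ltn (T_ l);
  T_range : forall l s, (l <= ld)%N -> s \in T_ l -> (1 <= s <= (n_ l).+1)%N
}.

Section Family.
Variable L : lacunary.

Definition lac_deg : nat := n_ L (ld L).
Definition tau (l : nat) : nat := size (T_ L l).
(* t_{l,i} with i counted from 1, so that t_ l (tau l) is the largest element *)
Definition t_ (l i : nat) : nat := nth 0%N (T_ L l) i.-1.

(* The pairs (l, i); the second component is i - 1. *)
Definition idx : finType := {l : 'I_(ld L).+1 & 'I_(tau l)}.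
Definition Xexp (j : idx) : nat := (t_ (tag j) (tagged j).+1 - 1)%N.
Definition Yexp (j : idx) : nat := (n_ L (tag j) - Xexp j)%N.

Definition lac_dim : nat := (\sum_(l < (ld L).+1) tau l)%N.
Definition tbar : nat :=
  (\sum_(l < (ld L).+1) \sum_(1 <= i < (tau l).+1) t_ l i)%N.
Definition taunbar : nat := (\sum_(l < (ld L).+1) tau l * n_ L l)%N.
Definition taubar : nat :=
  (\sum_(l < (ld L).+1) (tau l * (tau l).+1) %/ 2)%N.
Definition taubar' : nat :=
  (\sum_(l < (ld L).+1) (tau l * (tau l).-1) %/ 2)%N.

Definition Cbar (R : realType) : R :=
  \prod_(l < (ld L).+1) \prod_(1 <= i < (tau l).+1)
    ((\prod_(1 <= j < i) ((t_ l i)%:R - (t_ l j)%:R)) / (i.-1)`!%:R).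

End Family.

Section Curve.
Variables (R : realType) (P1 P2 : {poly R[i]}).

Definition nu (P : {poly R[i]}) : nat := mup 0 P.
Definition maxdeg : nat := maxn (size P1).-1 (size P2).-1.
Definition alpha_ (i : nat) : R[i] := P1`_(nu P1 + i).
Definition a_ (i : nat) : R[i] := P2`_(nu P2 + i).
Definition mu : R[i] := alpha_ 0 / a_ 0.

Definition coef_agree (k : nat) : Prop :=
  forall i, (i <= k)%N -> alpha_ i = mu * a_ i.
Definition is_contact_order (k : nat) : Prop :=
  coef_agree k /\ forall k', coef_agree k' -> (k' <= k)%N.
Definition delta (k : nat) : R[i] := alpha_ k.+1 - mu * a_ k.+1.

Variable L : lacunary.

(* Q_lambda as a polynomial in Y with coefficients in R[i][X] *)
Definition Q_ (lam : {ffun idx L -> R[i]}) : {poly {poly R[i]}} :=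
  \sum_(j : idx L) (lam j *: 'X^(Xexp j))%:P * 'X^(Yexp j).
Definition f_ (lam : {ffun idx L -> R[i]}) : {poly R[i]} :=
  (map_poly (comp_poly P1) (Q_ lam)).[P2].

Definition B1 : R :=
  sup [set x | exists (z : R[i]) (j : idx L),
    cabs z <= 1 /\ x = cabs (P1.[z] ^+ Xexp j * P2.[z] ^+ Yexp j)].

Definition nubar (l : nat) : nat :=
  ((t_ L l 1 - 1) * nu P1 + (n_ L l - (t_ L l 1 - 1)) * nu P2)%N.
Definition nutilde (l : nat) : nat :=
  ((t_ L l (tau L l) - 1) * nu P1
   + (n_ L l - (t_ L l (tau L l) - 1)) * nu P2)%N.

(* In both cases the lacunarity conditions make the maximizing index unique. *)
Definition ell_eq (k : nat) : 'I_(ld L).+1 :=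
  [arg max_(l > ord0) (nubar l + k.+1 * tau L l)%N].
Definition ell_neq : 'I_(ld L).+1 := [arg max_(l > ord0) nutilde l].

Definition lacunarity1 : Prop :=
  forall l, (l < ld L)%N -> (nu P2 * n_ L l.+1 > n_ L l * maxdeg)%N.
Definition lacunarity2 (k : nat) : Prop :=
  nu P1 = nu P2 /\ forall l, (l < ld L)%N ->
    (nu P2 * n_ L l.+1 > nu P2 * n_ L l + k.+1 * (tau L l - 1))%N.
Definition lacunarity3 : Prop :=
  nu P1 <> nu P2 /\ forall l, (l < ld L)%N -> (nubar l.+1 > nutilde l)%N.
Definition lacunarity4 (k : nat) : Prop :=
  nu P1 = nu P2 /\ forall l l', (l <= ld L)%N -> (l' <= ld L)%N ->
    (l > l')%N -> nubar l = nubar l' %[mod k.+1] ->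
    (nubar l > nubar l' + k.+1 * (tau L l' - 1))%N.
(* nu P1 - nu P2 is |nu1 - nu2| when nu P2 <= nu P1 *)
Definition lacunarity5 : Prop :=
  nu P1 <> nu P2 /\ forall l l', (l <= ld L)%N -> (l' <= ld L)%N ->
    (l > l')%N -> nubar l = nubar l' %[mod (nu P1 - nu P2)%N] ->
    (nubar l > nutilde l')%N.
Definition lacunarity (k : nat) : Prop :=
  [\/ lacunarity1, lacunarity2 k, lacunarity3 | lacunarity4 k \/ lacunarity5].

End Curve.

Section Zeros.
Variable R : realType.

(* Number of zeros of g in the closed disc of radius rho, with multiplicity;
   meaningful only for g != 0. *)
Definition nzeros (g : {poly R[i]}) (rho : R) : nat :=
  \big[addn/0%N]_(z \in [set z : R[i] | cabs z <= rho]) mup z g.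

Definition is_max_nzeros (P1 P2 : {poly R[i]}) (L : lacunary) (rho : R)
    (Z : nat) : Prop :=
  (exists2 lam : {ffun idx L -> R[i]},
     f_ P1 P2 lam != 0 & nzeros (f_ P1 P2 lam) rho = Z) /\
  forall lam : {ffun idx L -> R[i]},
    f_ P1 P2 lam != 0 -> (nzeros (f_ P1 P2 lam) rho <= Z)%N.

(* The zero polynomial has infinitely many zeros. *)
Definition at_most_zeros (g : {poly R[i]}) (rho : R) (N : nat) : Prop :=
  g != 0 /\ (nzeros g rho <= N)%N.

End Zeros.

(* Main.v *)
(* The m monomials P1^x P2^y of the family are bounded by 1 on the unit disc,
   so by Parseval their coefficient vectors have norm at most 1.  There are
   m columns, all of index at most N, whose m x m minor D is triangular up to
   a change of basis, hence explicit.  Cramer's rule and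
   Hadamard's inequality then bound lambda by m^(1/2) max_{k<=N} |f_k| / D:
   every Taylor coefficient of f_lambda is dominated by the first N+1 ones.
   Domination bounds the zeros in two ways.  In the disc of radius 1/4, a
   Blaschke-type comparison of sup |f| on |z| = 1/4 and |z| = 1/2 gives
   (5/4)^n <= 2^N (2 + c).  In the small disc, K+1 zeros make the divided
   difference of f at them vanish, which bounds |f_K| by a small multiple of
   the other coefficients; this is impossible for the dominant f_K, K <= N.
   If nu1 <> nu2, the lacunarity conditions say that the monomials vanish at 0
   to distinct orders, and the columns are these orders.  If nu1 = nu2, write
   P1 = mu P2 + S with S = delta z^(nu+k+1) + ...; Newton interpolation in the
   exponent x replaces the monomials of degree n_l by combinations of the
   S^r P2^(n_l-r), which vanish to the distinct orders nu n_l + (k+1) r. *)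

Require Import Defs.
From mathcomp Require Import all_boot all_order all_algebra.
From mathcomp Require Import perm cyclic separable cyclotomic complex.
From mathcomp Require Import all_classical all_reals all_analysis.
From mathcomp Require Import ring lra zify.

Set Implicit Arguments.
Unset Strict Implicit.
Unset Printing Implicit Defensive.
Import Order.TTheory GRing.Theory Num.Theory.
Local Open Scope ring_scope.

(** * Parseval and Hadamard inequalities *)

Section NumClosed.
Variable C : numClosedFieldType.

(** In characteristic 0 the polynomial [X^n - 1] is separable, so it has n distinct roots, and among
    n distinct n-th roots of unity one is primitive. *)
Lemma prim_root_exists n : (0 < n)%N -> exists w : C, n.-primitive_root w.
Proof.
pose p : {poly C} := 'X^n - 1; have [r Dp] := closed_field_poly_normal p.
move=> n_gt0; rewrite (monicP _) ?monicXnsubC // scale1r in Dp.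
have rn1: all n.-unity_root r by apply/allP=> z; rewrite -root_prod_XsubC -Dp.
have sz_r: (n < (size r).+1)%N.
  by rewrite -(size_prod_XsubC r id) -Dp size_XnsubC.
have [|z] := hasP (has_prim_root n_gt0 rn1 _ sz_r); last by exists z.
by rewrite -separable_prod_XsubC -Dp separable_Xn_sub_1 // pnatr_eq0 -lt0n.
Qed.

Lemma norm_prim_root n (w : C) : n.-primitive_root w -> `|w| = 1.
Proof.
move=> pw; have n0 := prim_order_gt0 pw.
apply: (@pexpIrn _ n) => //; rewrite ?nnegrE //.
by rewrite -normrX (prim_expr_order pw) normr1 expr1n.
Qed.

(** Orthogonality of characters: since conjugation inverts [w], this is a geometric sum in
    [x = w^(i-j)], where [x^n = 1] and [x = 1] only for [i = j]. *)
Lemma sum_prim_root n (w : C) (i j : nat) : n.-primitive_root w ->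
  (i < n)%N -> (j < n)%N ->
  \sum_(s < n) (w ^+ s) ^+ i * ((w ^+ s) ^+ j)^* = (n * (i == j))%:R.
Proof.
move=> pw ltin ltjn; have n1 := norm_prim_root pw.
have w0 : w != 0 by rewrite -normr_eq0 n1 oner_eq0.
have cw : w^* = w^-1 by rewrite invC_norm n1 expr1n invr1 mul1r.
pose x := w ^+ i / w ^+ j.
have E (s : 'I_n) : (w ^+ s) ^+ i * ((w ^+ s) ^+ j)^* = x ^+ s.
  by rewrite !rmorphXn /= cw exprVn exprVn exprMn exprVn -!exprM ![(s * _)%N]mulnC.
under eq_bigr do rewrite E.
have [eij|nij] := eqVneq i j.
  rewrite muln1 /x eij divff ?expf_neq0 //.
  by under eq_bigr do rewrite expr1n; rewrite sumr_const card_ord.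
rewrite muln0; have x1 : x - 1 != 0.
  rewrite subr_eq0; apply: contra nij => /eqP x1.
  have : w ^+ i == w ^+ j by rewrite -[w ^+ i](divfK (expf_neq0 j w0)) -/x x1 mul1r.
  by rewrite (eq_prim_root_expr pw) !modn_small.
apply/(mulfI x1); rewrite mulr0 -subrX1 /x exprMn exprVn -!exprM.
by rewrite ![(_ * n)%N]mulnC !exprM (prim_expr_order pw) !expr1n invr1 mulr1 subrr.
Qed.

(** Averaging over the n-th roots of unity replaces integration over the circle; the result is exact
    once n exceeds the degree. *)
Lemma parseval_prim_root n (w : C) (p : {poly C}) : n.-primitive_root w ->
  (size p <= n)%N ->
  \sum_(s < n) `|p.[w ^+ s]| ^+ 2 = n%:R * \sum_(i < n) `|p`_i| ^+ 2.
Proof.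
move=> pw sp.
have E (s : 'I_n) : `|p.[w ^+ s]| ^+ 2 =
    \sum_(i < n) \sum_(j < n) p`_i * (p`_j)^* * ((w ^+ s) ^+ i * ((w ^+ s) ^+ j)^*).
  rewrite normCK (horner_coef_wide _ sp) rmorph_sum /= mulr_suml.
  apply: eq_bigr => i _; rewrite mulr_sumr; apply: eq_bigr => j _.
  by rewrite rmorphM /= mulrACA.
under eq_bigr do rewrite E.
rewrite exchange_big /= mulr_sumr; apply: eq_bigr => i _.
rewrite exchange_big /= (bigD1 i) //= [X in _ + X]big1 ?addr0 => [|j ji].
  rewrite -mulr_sumr (sum_prim_root pw) // eqxx muln1 normCK.
  by rewrite mulrC.
by rewrite -mulr_sumr (sum_prim_root pw) // -val_eqE eq_sym in ji *; rewrite (negPf ji) muln0 mulr0.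
Qed.

Lemma parseval_le (p : {poly C}) : (forall z, `|z| = 1 -> `|p.[z]| <= 1) ->
  forall (I : finType) (kap : I -> nat), injective kap ->
  \sum_i `|p`_(kap i)| ^+ 2 <= 1.
Proof.
move=> p1 I kap ikap.
(* Large enough for the degree of [p] and for every selected index [kap i]. *)
pose n := maxn (size p).+1 (\max_i (kap i)).+1.
have n0 : (0 < n)%N by rewrite leq_max.
have [w pw] := prim_root_exists n0.
have sp : (size p <= n)%N by rewrite leq_max leqnSn.
have kn i : (kap i < n)%N by rewrite leq_max [X in _ || X]ltnS leq_bigmax ?orbT.
have H : \sum_(i < n) `|p`_i| ^+ 2 <= 1.
  rewrite -(ler_pM2l (_ : 0 < n%:R)) ?ltr0n // -(parseval_prim_root pw sp) mulr1.
  rewrite -[X in _ <= X%:R]card_ord -sumr_const ler_sum // => s _.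
  rewrite expr_le1 // p1 // normrX (norm_prim_root pw) expr1n //.
apply: le_trans H; pose h i := Ordinal (kn i).
have ih : injective h by move=> i j /(congr1 val) /ikap.
rewrite [leRHS](bigID (fun j => j \in codom h)) /= -[leLHS]addr0 lerD //; last first.
  by apply: sumr_ge0 => i _; rewrite exprn_ge0.
have -> : \sum_(i < n | i \in codom h) `|p`_i| ^+ 2 = \sum_(i in [set h x | x in I]%SET) `|p`_i| ^+ 2.
  apply: eq_bigl => i; apply/codomP/imsetP => [[x ->]|[x _ ->]]; by exists x.
rewrite big_imset //=; exact: in2W.
Qed.

Local Open Scope sesquilinear_scope.

Lemma trCmxE (m n : nat) (A : 'M[C]_(m, n)) i j : (A ^t*) i j = (A j i)^*.
Proof. by rewrite !mxE. Qed.

Lemma mulmx_trC_diag (m n : nat) (A : 'M[C]_(m, n)) i :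
  (A *m A ^t*) i i = \sum_j `|A i j| ^+ 2.
Proof. by rewrite mxE; apply: eq_bigr => j _; rewrite trCmxE normCK. Qed.

(** Row i of [A] lies in the span of the rows k <= i of its Schmidt matrix, which are orthogonal to
    the later rows. *)
Lemma schmidt_trig n (A : 'M[C]_n) : is_trig_mx (A *m (schmidt A) ^t*).
Proof.
set B := schmidt A.
have uB : B \is unitarymx by apply: schmidt_unitarymx.
apply/is_trig_mxP => i j ltij.
have -> : (A *m B^t*) i j = (row i A *m (row j B)^t*) 0 0.
  by rewrite [LHS]mxE [RHS]mxE; apply: eq_bigr => k _; rewrite trCmxE trCmxE !mxE.
suff -> : row i A *m (row j B)^t* = 0 by rewrite mxE.
have /sub_sumsmxP[u ->] := row_schmidt_sub A i.
rewrite mulmx_suml big1 // => k ki.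
have : (<<row k B>> <= row k B)%MS by rewrite genmxE.
move=> /submxP[D ->]; rewrite -!mulmxA.
suff -> : row k B *m (row j B)^t* = 0 by rewrite !mulmx0.
apply/matrixP => a b; rewrite [RHS]mxE [LHS]mxE.
have : (B *m B^t*) k j = 0.
  by rewrite (unitarymxP uB) mxE -val_eqE /= (ltn_eqF (leq_ltn_trans ki ltij)).
rewrite [X in X = _ -> _]mxE => E; rewrite -[RHS]E.
by apply: eq_bigr => l _; rewrite !trCmxE !mxE.
Qed.

(** Write [A = L B] with [B] unitary and [L] lower triangular. Then |det A| is the product of the
    |L_ii|, and |L_ii| is at most the norm of row i of [L], which equals that of row i of [A]. *)
Lemma hadamard n (A : 'M[C]_n) :
  `|\det A| ^+ 2 <= \prod_i \sum_j `|A i j| ^+ 2.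
Proof.
set B := schmidt A.
have uB : B \is unitarymx by apply: schmidt_unitarymx.
have dB : `|\det B| ^+ 2 = 1.
  by rewrite normCK -[X in _ * X^*]det_tr -det_map_mx -det_mulmx (unitarymxP uB) det1.
set L := A *m B^t*.
have AE : A = L *m B by rewrite /L mulmxKtV.
rewrite AE det_mulmx normrM exprMn dB mulr1 det_trig ?schmidt_trig //.
rewrite normr_prod -prodrXl; apply: ler_prod => i _; rewrite exprn_ge0 //=.
rewrite -AE -mulmx_trC_diag AE trmx_mul map_mxM !mulmxA mulmxtVK // mulmx_trC_diag.
by rewrite (bigD1 i) //= lerDl sumr_ge0 // => j _; rewrite exprn_ge0.
Qed.

End NumClosed.

(** * Cramer's rule with Hadamard's bound; triangularity for an arbitrary order *)

Section Cramer.
Variable C : numClosedFieldType.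

(** The cofactors along row j do not involve row j, so the expansion along it is entry j of
    [lam M adj(M) = det(M) lam]. *)
Lemma cramer_row m (M : 'M[C]_m) (lam : 'rV[C]_m) j :
  \det (\matrix_(i, k) (if i == j then (lam *m M) 0 k else M i k))
    = lam 0 j * \det M.
Proof.
rewrite (expand_det_row _ j).
transitivity ((lam *m M *m \adj M) 0 j).
  rewrite [RHS]mxE; apply: eq_bigr => k _; rewrite !mxE eqxx; congr (_ * _).
  rewrite /cofactor; congr (_ * \det _); apply/matrixP => a b.
  by rewrite !mxE eq_sym (negPf (neq_lift _ _)).
by rewrite -mulmxA mul_mx_adj mul_mx_scalar mxE mulrC.
Qed.

(** Hadamard's inequality for the matrix of [cramer_row]: the replaced row has squared norm at most
    [m A^2], the others at most 1. *)
Lemma cramer_bound m (M : 'M[C]_m) (lam : 'rV[C]_m) (A : C) :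
  (forall i, \sum_k `|M i k| ^+ 2 <= 1) -> 0 <= A ->
  (forall k, `|(lam *m M) 0 k| <= A) ->
  forall j, `|lam 0 j| * `|\det M| <= sqrtC m%:R * A.
Proof.
move=> M1 A0 cA j; rewrite -normrM -cramer_row.
rewrite -(ler_pXn2r (ltn0Sn 1)) ?nnegrE ?mulr_ge0 ?sqrtC_ge0 //.
apply: le_trans (hadamard _) _.
rewrite exprMn sqrtCK (bigD1 j) //=.
have H1 : \prod_(i < m | i != j) \sum_(j0 < m)
   `|(\matrix_(i0, k) (if i0 == j then (lam *m M) 0 k else M i0 k)) i j0| ^+ 2 <= 1.
  apply: prodr_ile1 => i ij; rewrite sumr_ge0 => [/=|k _]; last by rewrite exprn_ge0.
  by apply: le_trans (M1 i); apply: ler_sum => k _; rewrite mxE (negPf ij).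
have H2 : \sum_(j0 < m)
   `|(\matrix_(i0, k) (if i0 == j then (lam *m M) 0 k else M i0 k)) j j0| ^+ 2
   <= m%:R * A ^+ 2.
  rewrite mulr_natl -[X in _ *+ X]card_ord -sumr_const; apply: ler_sum => k _.
  by rewrite mxE eqxx lerXn2r // ?nnegrE.
rewrite -[leRHS]mulr1 ler_pM //.
  by apply: sumr_ge0 => k _; rewrite exprn_ge0.
by apply: prodr_ge0 => i _; apply: sumr_ge0 => k _; rewrite exprn_ge0.
Qed.

(** The matrix is triangular for the order given by [kap], not for that of the indices. If a
    permutation s satisfies [kap i <= kap (s i)] for all i, then equality of the two sums forces
    [kap (s i) = kap i], so s = 1; any other s meets a zero entry. *)
Lemma det_trig_inj (R : comNzRingType) m (M : 'M[R]_m) (kap : 'I_m -> nat) :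
  injective kap -> (forall i j, (kap j < kap i)%N -> M i j = 0) ->
  \det M = \prod_i M i i.
Proof.
move=> ik M0; rewrite /determinant (bigD1 (1%g : 'S_m)) //= odd_perm1 expr0 mul1r.
rewrite [X in _ + X]big1 ?addr0 => [|s s1]; first by apply: eq_bigr => i _; rewrite perm1.
suff [i lti] : exists i, (kap (s i) < kap i)%N by rewrite (bigD1 i) //= M0 // mul0r mulr0.
apply/existsP; apply: contraR s1; rewrite negb_exists => /forallP H.
apply/eqP/permP => i; rewrite perm1; apply: ik; apply/esym.
have le j : (kap j <= kap (s j))%N by rewrite leqNgt.
have : (\sum_j kap (s j) <= \sum_j kap j)%N.
  by rewrite [X in (_ <= X)%N](reindex_inj (@perm_inj _ s)).
have /leqifP := leqif_sum (fun j (_ : true) => conj (le j) (erefl (kap j == kap (s j)))).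
case: ifP => [/forallP/(_ i)/eqP // | _]; by rewrite ltnNge => /negP.
Qed.

End Cramer.

(** * Polynomials on complex discs *)

Section Cabs.
Variable R : realType.
Local Notation C := R[i].

Lemma normE (z : C) : `|z| = ((cabs z)%:C)%C.
Proof. by case: z. Qed.

Lemma norm_le1 (z : C) : (`|z| <= 1) = (cabs z <= 1).
Proof. by rewrite normE -(rmorph1 (real_complex R)) lecR. Qed.

Lemma norm_eq1 (z : C) : (`|z| = 1) -> (cabs z = 1).
Proof. by rewrite normE => H; apply: complexI; rewrite H. Qed.

Lemma cabs_ge0 (z : C) : 0 <= cabs z.
Proof. by rewrite -ler0c -normE normr_ge0. Qed.

Lemma cabsM (x y : C) : cabs (x * y) = cabs x * cabs y.
Proof. exact: ComplexField.Normc.normcM. Qed.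

Lemma cabs1 : cabs (1 : C) = 1.
Proof. exact: ComplexField.Normc.normc1. Qed.

Lemma cabs0 : cabs (0 : C) = 0.
Proof. exact: ComplexField.Normc.normc0. Qed.

Lemma cabs_eq0 (x : C) : (cabs x == 0) = (x == 0).
Proof.
apply/eqP/eqP => [/ComplexField.Normc.eq0_normc // | ->]; exact: cabs0.
Qed.

Lemma cabs_gt0 (x : C) : (0 < cabs x) = (x != 0).
Proof. by rewrite lt0r cabs_ge0 andbT cabs_eq0. Qed.

Lemma cabsV (x : C) : cabs x^-1 = (cabs x)^-1.
Proof. exact: ComplexField.Normc.normcV. Qed.

Lemma cabsX (x : C) n : cabs (x ^+ n) = cabs x ^+ n.
Proof. by elim: n => [|n IH]; rewrite ?expr0 ?cabs1 // !exprS cabsM IH. Qed.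

Lemma cabsN (x : C) : cabs (- x) = cabs x.
Proof. by apply: complexI; rewrite -!normE normrN. Qed.

Lemma cabsD (x y : C) : cabs (x + y) <= cabs x + cabs y.
Proof. by rewrite -lecR rmorphD /= -!normE ler_normD. Qed.

Lemma cabs_prod (I : Type) (r : seq I) (P : pred I) (F : I -> C) :
  cabs (\prod_(i <- r | P i) F i) = \prod_(i <- r | P i) cabs (F i).
Proof. exact: (big_morph _ cabsM cabs1). Qed.

Lemma cabs_sum (I : Type) (r : seq I) (P : pred I) (F : I -> C) :
  cabs (\sum_(i <- r | P i) F i) <= \sum_(i <- r | P i) cabs (F i).
Proof.
elim/big_ind2: _ => [|x1 x2 y1 y2 H1 H2|//]; first by rewrite cabs0.
by apply: (@le_trans _ R _ _ _) (cabsD _ _) _; rewrite lerD.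
Qed.

Lemma cabs_real (x : R) : 0 <= x -> cabs (x%:C)%C = x.
Proof. by move=> x0; apply: complexI; rewrite -normE ger0_norm // ler0c. Qed.

Lemma cabs_nat n : cabs (n%:R : C) = n%:R.
Proof. by rewrite -(rmorph_nat (real_complex R)) cabs_real ?ler0n. Qed.

Lemma cabs_conj (x : C) : cabs (x^*) = cabs x.
Proof. by apply: complexI; rewrite -!normE norm_conjC. Qed.

Lemma sqr_cabs (x : C) : cabs x ^+ 2 = complex.Re x ^+ 2 + complex.Im x ^+ 2.
Proof. by case: x => a b /=; rewrite sqr_sqrtr // addr_ge0 ?sqr_ge0. Qed.

Definition scale_poly (r : R) (p : {poly C}) : {poly C} :=
  \poly_(k < size p) (p`_k * (r%:C)%C ^+ k).

Lemma coef_scale_poly r p k : (scale_poly r p)`_k = p`_k * (r%:C)%C ^+ k.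
Proof.
by rewrite coef_poly; case: ltnP => // le; rewrite nth_default ?mul0r.
Qed.

Lemma horner_scale_poly r p z : (scale_poly r p).[z] = p.[(r%:C)%C * z].
Proof.
rewrite horner_poly horner_coef; apply: eq_bigr => i _.
by rewrite exprMn mulrA.
Qed.

(** Parseval for [p(rX)/B] with one selected coefficient takes the place of a contour integral. *)
Lemma cauchy_estimate (p : {poly C}) (r B : R) : 0 < r -> 0 < B ->
  (forall z, cabs z = r -> cabs p.[z] <= B) ->
  forall k, cabs p`_k * r ^+ k <= B.
Proof.
move=> r0 B0 pB k.
have := @parseval_le _ ((B^-1)%:C%C *: scale_poly r p) _ 'I_1 (fun=> k).
rewrite big_ord1 coefZ coef_scale_poly => H.
have {H} : `|(B^-1)%:C%C * (p`_k * (r%:C)%C ^+ k)| ^+ 2 <= 1.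
  apply: H => [z z1|i j _]; last by rewrite !ord1.
  rewrite hornerZ horner_scale_poly norm_le1 cabsM cabs_real ?invr_ge0 ?(ltW r0) ?(ltW B0) //.
  rewrite ler_pdivrMl // mulr1; apply: pB.
  by rewrite cabsM cabs_real ?(ltW r0) ?(ltW B0) // norm_eq1 // mulr1.
rewrite expr_le1 // norm_le1 !cabsM cabsX !cabs_real ?invr_ge0 ?(ltW r0) ?(ltW B0) //.
by rewrite ler_pdivrMl // mulr1.
Qed.

(* By Bernoulli's inequality, t ^+ k grows at least quadratically if t > 1. *)
Lemma expr_le_linear (t d : R) : 0 <= d -> 0 <= t ->
  (forall k, t ^+ k <= k%:R * d + 1) -> t <= 1.
Proof.
move=> d0 t0 H; rewrite leNgt; apply/negP => t1.
have [e te] : exists e, t = 1 + e by exists (t - 1); rewrite addrC subrK.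
have e0 : 0 < e by lra.
have bern k : 1 + k%:R * e <= t ^+ k.
  elim: k => [|k IH]; first by rewrite mul0r addr0 expr0.
  rewrite exprS -[k.+1%:R]natr1.
  have := ler_wpM2l t0 IH; rewrite {1}te.
  have : 0 <= k%:R * e ^+ 2 by rewrite mulr_ge0 ?sqr_ge0.
  lra.
(* This makes [k e^2 > 2 d]. At exponent 2k, [(1 + k e)^2 <= 2 k d + 1] then forces [k e = 0], hence
   k = 0, contradicting the choice. *)
pose k := Num.bound (2 * d / e ^+ 2).
have kb : 2 * d / e ^+ 2 < k%:R.
  by apply: archi_boundP; rewrite divr_ge0 ?sqr_ge0 ?mulr_ge0.
move: kb; rewrite ltr_pdivrMr ?exprn_gt0 // => kb.
have := H (k * 2)%N; rewrite exprM natrM => H2.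
have b := bern k; have k0 : 0 <= k%:R :> R by rewrite ler0n.
have : (1 + k%:R * e) ^+ 2 <= t ^+ k ^+ 2.
  by apply: lerXn2r => //; rewrite nnegrE ?exprn_ge0 // addr_ge0 ?mulr_ge0 // ltW.
move=> H3; have {H2 H3} := le_trans H3 H2.
have : k%:R * (2 * d) <= k%:R * (k%:R * e ^+ 2) by rewrite ler_wpM2l // ltW.
have : 0 <= k%:R * e by rewrite mulr_ge0 // ltW.
move=> h1 h2 h3.
have ke0 : k%:R * e = 0 by lra.
have k00 : k%:R = 0 :> R by move/eqP: ke0; rewrite mulf_eq0 (gt_eqF e0) orbF => /eqP.
move: kb; rewrite k00 mul0r; lra.
Qed.

(* Cauchy's estimate for p ^+ k gives |p(x)|^k <= (k deg p + 1) B^k; let k grow. *)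
Lemma max_principle (p : {poly C}) (r B : R) : 0 < r -> 0 < B ->
  (forall z, cabs z = r -> cabs p.[z] <= B) ->
  forall x, cabs x <= r -> cabs p.[x] <= B.
Proof.
move=> r0 B0 pB x xr; rewrite -[B]mul1r -ler_pdivrMr //.
apply: (@expr_le_linear _ (size p).-1%:R) => //.
  by rewrite divr_ge0 ?cabs_ge0 // ltW.
move=> k; rewrite expr_div_n ler_pdivrMr ?exprn_gt0 //.
rewrite -cabsX -horner_exp horner_coef.
apply: (@le_trans _ R); first exact: cabs_sum.
have Bk : 0 < B ^+ k by rewrite exprn_gt0.
have E (i : nat) : cabs ((p ^+ k)`_i * x ^+ i) <= B ^+ k.
  rewrite cabsM cabsX.
  apply: (@le_trans _ R _ _ _) (_ : cabs (p ^+ k)`_i * r ^+ i <= _).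
    by rewrite ler_wpM2l ?cabs_ge0 // lerXn2r ?nnegrE ?cabs_ge0 // (ltW r0).
  apply: cauchy_estimate => // z zr; rewrite horner_exp cabsX.
  by rewrite lerXn2r ?nnegrE ?cabs_ge0 ?(ltW B0) // pB.
apply: (@le_trans _ R); first by apply: ler_sum => i _; exact: E.
rewrite sumr_const card_ord -[leLHS]mulr_natl; apply: (@ler_wpM2r R); first exact: ltW.
by rewrite -natrM natr1 ler_nat mulnC size_poly_exp_leq.
Qed.

(** In the disc of radius 1/2, two points of modulus at most 1/4 have pseudo-hyperbolic distance at
    most 4/5; the extreme case is [x = -a] with [|a| = 1/4]. *)
Lemma pseudo_hyperbolic (a x : C) : cabs a <= 1 / 4 -> cabs x <= 1 / 4 ->
  5 * cabs (x - a) <= 8 * cabs (1 / 4 - a^* * x).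
Proof.
move=> a4 x4.
rewrite -(ler_pXn2r (ltn0Sn 1)) ?nnegrE ?mulr_ge0 ?cabs_ge0 //.
rewrite !exprMn !sqr_cabs.
have := cabs_ge0 a; have := cabs_ge0 x; have := sqr_cabs a; have := sqr_cabs x.
have -> : (1 / 4 : C) = ((1 / 4)%:C)%C.
  by rewrite -[4]/(4%:R) rmorphM fmorphV rmorph_nat rmorph1.
have -> : a^* = (a^*)%C by [].
move: a4 x4; set p := cabs a; set q := cabs x.
case: {+}a => a1 a2; case: {+}x => x1 x2 /= p4 q4 hq hp q0 p0.
(* Let t be the real part of [a^* x]. The difference of the two squares is affine and increasing in
   t; at [t = - p q] it is the product in [h2]. Cauchy-Schwarz, [h3], gives [t >= - p q]. *)
have h1 : 0 <= 2 + 8 * (p * q) - 5 * p - 5 * q by nra.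
have h2 : 0 <= (2 + 8 * (p * q) - 5 * p - 5 * q) * (2 + 8 * (p * q) + 5 * p + 5 * q).
  by rewrite mulr_ge0 // !addr_ge0 // ?mulr_ge0.
have h3 : - (p * q) <= a1 * x1 + a2 * x2.
  have : (a1 * x1 + a2 * x2) ^+ 2 <= (p * q) ^+ 2.
    rewrite exprMn hp hq.
    have := sqr_ge0 (a1 * x2 - a2 * x1); lra.
  have pq0 : 0 <= p * q by rewrite mulr_ge0.
  nra.
nra.
Qed.

End Cabs.

(** * Reflection of zeros, and divided differences *)

Section ZeroCount.
Variable R : realType.
Local Notation C := R[i].

(** On this circle [1/4 = z z^*], so [1/4 - a^* z = z (z - a)^*]. *)
Lemma cabs_circle (a z : C) : cabs z = 1 / 2 ->
  cabs (z - a) = 2 * cabs (1 / 4 - a^* * z).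
Proof.
move=> z2; have -> : 1 / 4 - a^* * z = z * (z - a)^*.
  have zz : z * z^* = 1 / 4.
    rewrite -normCK normE z2 -rmorphXn /= expr_div_n expr1n.
    rewrite rmorphM fmorphV rmorph1 -[4]/(4%:R) -natrX.
    by rewrite (rmorph_nat (real_complex R)).
  by rewrite rmorphB mulrBr zz [a^* * z]mulrC.
by rewrite cabsM z2 cabs_conj; field.
Qed.

(* Each factor 'X - a is replaced by 2 (1/4 - a^* 'X), which has the same modulus
   on |z| = 1/2 and at least 5/4 times the modulus on |z| <= 1/4. *)
Lemma zeros_contract (s : seq C) : (forall a, a \in s -> cabs a <= 1 / 4) ->
  forall (q : {poly C}) (B : R), 0 < B ->
  (forall z, cabs z = 1 / 2 ->
     cabs (q * \prod_(a <- s) ('X - a%:P)).[z] <= B) ->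
  forall x, cabs x <= 1 / 4 ->
  (5 / 4) ^+ size s * cabs (q * \prod_(a <- s) ('X - a%:P)).[x] <= B.
Proof.
elim: s => [|a s IH] sB q B B0 qB x x4.
  rewrite /= expr0 mul1r; apply: (@max_principle _ _ (1 / 2) _ _ B0 qB); lra.
have a4 : cabs a <= 1 / 4 by apply: sB; rewrite mem_head.
have {}IH := IH (fun b bs => sB b (mem_behead (s := a :: s) bs)).
(* The statement is quantified over [q] so that the reflected factor can be absorbed into it before
   the induction hypothesis is applied. *)
pose q' := q * (2 *: ((1 / 4)%:P - a^* *: 'X)).
have q'E z : cabs (q' * \prod_(b <- s) ('X - b%:P)).[z] =
   cabs (q * \prod_(b <- s) ('X - b%:P)).[z] * (2 * cabs (1 / 4 - a^* * z)).
  rewrite !hornerM hornerZ hornerD hornerN hornerZ hornerX hornerC !cabsM.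
  by rewrite cabs_nat; ring.
have qE z : cabs (q * \prod_(b <- a :: s) ('X - b%:P)).[z] =
   cabs (q * \prod_(b <- s) ('X - b%:P)).[z] * cabs (z - a).
  by rewrite big_cons !hornerM hornerXsubC !cabsM; ring.
have H := IH q' B B0 _ x x4; rewrite qE /= exprS.
apply: (@le_trans _ R _ _ _ _ (H _)); last first.
  by move=> z z2; rewrite q'E -cabs_circle // -qE qB.
rewrite q'E; have := pseudo_hyperbolic a4 x4.
have : 0 <= (5 / 4) ^+ size s * cabs (q * \prod_(b <- s) ('X - b%:P)).[x].
  by rewrite mulr_ge0 ?cabs_ge0 // exprn_ge0.
set u := (5 / 4) ^+ size s; set v := cabs (_).[x]; set w := cabs (x - a); set y := cabs _.
move=> uv wy; have : 0 <= u * v * (8 * y - 5 * w) by rewrite mulr_ge0 // subr_ge0.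
lra.
Qed.

(* [hsym s k] is the complete homogeneous symmetric polynomial of degree
   [k + 1 - size s] in the points of [s]: the divided difference of ['X^k]. *)
Fixpoint hsym (s : seq C) : nat -> C :=
  match s with
  | [::] => fun=> 0
  | z :: s' => fix h k := if k is k'.+1 then hsym s' k' + z * h k'
                          else (s' == [::])%:R
  end.

Arguments hsym : simpl never.

Lemma hsymS z s k : hsym (z :: s) k.+1 = hsym s k + z * hsym (z :: s) k.
Proof. by []. Qed.

Lemma hsym0 z s : hsym (z :: s) 0 = (s == [::])%:R.
Proof. by []. Qed.

Lemma hsym_small s k : (k.+1 < size s)%N -> hsym s k = 0.
Proof.
elim: s k => [//|z s IHs]; elim=> [|k IHk] lt; first by rewrite hsym0; case: (s) lt.
by rewrite hsymS IHs // IHk ?mulr0 ?addr0 // ltnW.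
Qed.

Lemma hsym_size s k : size s = k.+1 -> hsym s k = 1.
Proof.
elim: s k => [//|z s IHs] [|k] [sk]; first by rewrite hsym0 (size0nil sk).
by rewrite hsymS IHs // hsym_small ?mulr0 ?addr0 //= sk.
Qed.

(** The sum is the divided difference of [f] at the points of [s]. Writing [f = (X - z) g], the
    recurrence of [hsym] makes it telescope to the sum for [g] and the remaining points. *)
Lemma hsym_dvd s (f : {poly C}) M : \prod_(z <- s) ('X - z%:P) %| f ->
  (size f <= M)%N -> \sum_(k < M) f`_k * hsym s k = 0.
Proof.
elim: s f M => [|z s IHs] f M.
  by move=> _ _; apply: big1 => k _; rewrite mulr0.
case: M => [|M]; first by rewrite big_ord0.
rewrite big_cons => /dvdpP[q fE]; pose g := q * \prod_(a <- s) ('X - a%:P).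
have fg : f = g * ('X - z%:P) by rewrite fE /g -mulrA; congr (_ * _); exact: mulrC.
move=> sf; have sg : (size g <= M)%N.
  have [->|g0] := eqVneq g 0; first by rewrite size_poly0.
  by move: sf; rewrite fg size_Mmonic ?monicXsubC // size_XsubC addn2.
have gs : \sum_(k < M) g`_k * hsym s k = 0 by apply: IHs => //; apply: dvdp_mull.
have f0 : f`_0 = - (g`_0 * z) by rewrite fg mulrBr coefB coefMX coefMC sub0r.
have fS k : f`_k.+1 = g`_k - g`_k.+1 * z by rewrite fg mulrBr coefB coefMX coefMC.
rewrite big_ord_recl f0.
have -> : \sum_(i < M) f`_(lift ord0 i) * hsym (z :: s) (lift ord0 i) =
  \sum_(i < M) g`_i * hsym s i + z * \sum_(i < M) g`_i * hsym (z :: s) i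
   - z * \sum_(i < M) g`_i.+1 * hsym (z :: s) i.+1.
  rewrite !mulr_sumr -big_split -sumrB /=; apply: eq_bigr => i _.
  by rewrite /bump ?add1n fS hsymS; ring.
have gM : g`_M = 0 by rewrite nth_default.
have -> : \sum_(i < M) g`_i * hsym (z :: s) i =
    g`_0 * hsym (z :: s) 0 + \sum_(i < M) g`_i.+1 * hsym (z :: s) i.+1.
  transitivity (\sum_(i < M.+1) g`_i * hsym (z :: s) i).
    by rewrite big_ord_recr /= gM mul0r addr0.
  by rewrite big_ord_recl.
rewrite gs /=; ring.
Qed.

(** The generating series of [hsym s] is [x^(n-1) / prod (1 - z x)] with n the size of [s]; at x = 1
    it is dominated by [(1 - r)^-n]. The double induction, on [s] and on the number of terms,
    removes one factor [1 - r] at a time. *)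
Lemma hsym_sum s (r : R) M : 0 <= r < 1 -> s != [::] ->
  (forall z, z \in s -> cabs z <= r) ->
  (1 - r) ^+ size s * \sum_(k < M) cabs (hsym s k) <= 1.
Proof.
move=> /andP[r0 r1]; elim: s M => [//|z s IHs] M _ sr.
have zr : cabs z <= r by apply: sr; rewrite mem_head.
have p0 : 0 < 1 - r by rewrite subr_gt0.
have H m : (1 - r) ^+ size s * ((s == [::])%:R + \sum_(k < m) cabs (hsym s k)) <= 1.
  case: (eqVneq s [::]) => [->|s0].
    by rewrite /= big1 ?addr0 ?mulr1 ?expr0 // => k _; exact: cabs0.
  by rewrite add0r; apply: IHs => // a as_; apply: sr; rewrite mem_behead.
elim: M => [|M IHM]; first by rewrite big_ord0 mulr0.
rewrite big_ord_recl hsym0 /= exprS.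
have := H M; move: IHM; rewrite /= exprS.
have E : \sum_(i < M) cabs (hsym (z :: s) (lift ord0 i)) <=
   \sum_(i < M) cabs (hsym s i) + r * \sum_(i < M) cabs (hsym (z :: s) i).
  rewrite mulr_sumr -big_split /=; apply: ler_sum => i _.
  rewrite /bump add1n hsymS; apply: (@le_trans _ R); first exact: cabsD.
  by rewrite lerD2l cabsM ler_wpM2r ?cabs_ge0.
have c0 : cabs ((s == [::])%:R : C) = (s == [::])%:R by rewrite cabs_nat.
rewrite c0; move: E.
have : 0 < (1 - r) ^+ size s by rewrite exprn_gt0.
set u := (1 - r) ^+ size s; set S := \sum_(i < M) cabs (hsym s i).
set b := (_ == _)%:R; set T := \sum_(i < M) cabs (hsym (z :: s) i).
set V := \sum_(i < M) _ => u0 VE IH HM.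
have : (1 - r) * (u * V) <= (1 - r) * (u * (S + r * T)).
  by rewrite !ler_wpM2l // ltW.
have : (1 - r) * (u * (b + S)) <= (1 - r) * 1 by rewrite ler_wpM2l // ltW.
have : r * ((1 - r) * u * T) <= r * 1 by rewrite ler_wpM2l.
lra.
Qed.

End ZeroCount.

(** * Zeros of polynomials with dominated coefficients *)

Lemma mup_prod_XsubC (F : fieldType) (x : F) (s : seq F) :
  mup x (\prod_(a <- s) ('X - a%:P)) = count_mem x s.
Proof.
have ne (r : seq F) : \prod_(a <- r) ('X - a%:P) != 0.
  by rewrite monic_neq0 // monic_prod_XsubC.
elim: s => [|a s IH].
  by rewrite big_nil mupNroot // root1.
rewrite big_cons mupM ?polyXsubC_eq0 // IH /=.
by rewrite -['X - a%:P]expr1 mup_XsubCX eq_sym; case: eqP.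
Qed.

Section Domination.
Variable R : realType.
Local Notation C := R[i].

(** The sum defining [nzeros] runs over an infinite set; only the roots in the disc contribute, so
    it is restricted to their finite list. *)
Lemma nzerosE (c : C) (s : seq C) rho : c != 0 ->
  nzeros (c *: \prod_(a <- s) ('X - a%:P)) rho = count (fun a => cabs a <= rho) s.
Proof.
move=> c0; pose t := [seq a <- s | cabs a <= rho].
have mE x : mup x (c *: \prod_(a <- s) ('X - a%:P)) = count_mem x s.
  by rewrite -mul_polyC mupMr ?rootC // mup_prod_XsubC.
rewrite /nzeros -size_filter -/t.
rewrite (eq_fsbigr (fun z => count_mem z t)); last first.
  move=> z /set_mem /= zr; rewrite mE /t count_filter; apply: eq_count => a /=.
  by case: eqP => // ->; rewrite zr.
rewrite -(fsbig_widen [set` undup t]); last 2 first.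
- by move=> z /=; rewrite mem_undup mem_filter => /andP[].
- by move=> z /= [_ /negP]; rewrite mem_undup => zt; apply/count_memPn.
rewrite -fsbig_seq ?undup_uniq // -[RHS]sum1_size -[RHS]big_undup_iterop_count.
apply: eq_bigr => i _; elim: (count_mem i t) => [//|n IH].
by rewrite [LHS](_ : _ = 1 + n)%N // {1}IH; case: (n).
Qed.

Lemma nzeros_split (f : {poly C}) rho : f != 0 ->
  exists2 s : seq C, (forall a, a \in s -> cabs a <= rho) /\ size s = nzeros f rho
    & exists q, f = q * \prod_(a <- s) ('X - a%:P).
Proof.
move=> f0; have [r Df] := closed_field_poly_normal f.
have l0 : lead_coef f != 0 by rewrite lead_coef_eq0.
exists [seq a <- r | cabs a <= rho]; first split.
- by move=> a; rewrite mem_filter => /andP[].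
- by rewrite Df nzerosE // size_filter.
exists (lead_coef f *: \prod_(a <- [seq a <- r | ~~ (cabs a <= rho)]) ('X - a%:P)).
rewrite [LHS]Df -scalerAl; congr (_ *: _); rewrite mulrC -big_cat /=.
by apply: perm_big; rewrite perm_sym; apply/permPl; apply: perm_filterC.
Qed.

(* The divided difference of f at K+1 of its zeros vanishes, so f_K is bounded by
   a sum of terms f_k hsym_k, k > K, which is small when rho is. *)
Lemma few_zeros (f : {poly C}) (A c rho : R) (N K : nat) :
  (0 < N)%N -> (K <= N)%N -> 0 < A -> cabs f`_K = A -> 1 <= c ->
  (forall k, cabs f`_k <= c * A) -> 0 <= rho -> rho <= 1 / (8 ^+ N * c) ->
  (nzeros f rho <= N)%N.
Proof.
move=> N0 KN A0 fK c1 fb rho0 rhoN; rewrite leqNgt; apply/negP => lt.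
have f0 : f != 0 by apply: contraTneq A0 => f0; rewrite -fK f0 coef0 cabs0 ltxx.
have [s [sr ss] [q fE]] := nzeros_split rho f0.
(* With exactly K+1 zeros, [hsym t K = 1], so [f_K] appears in the vanishing sum with coefficient
   1. *)
pose t := take K.+1 s.
have st : size t = K.+1 by rewrite size_takel // ss (leq_trans _ lt).
have tr a : a \in t -> cabs a <= rho by move=> /mem_take; exact: sr.
have td : \prod_(a <- t) ('X - a%:P) %| f.
  by rewrite fE -(cat_take_drop K.+1 s) big_cat /= mulrCA dvdp_mulr.
have c0 : 0 < c by lra.
(* Here N > 0 matters; N = 1 gives equality. It yields [(K+1) rho <= 1/(4c)], which keeps
   Bernoulli's lower bound for [(1 - rho)^(K+1)] near 1. *)
have N8 : N.+1%:R * 4 <= (8 : R) ^+ N.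
  rewrite -[4]/(4%:R) -[8]/(8%:R) -natrM -natrX ler_nat.
  case: (N) N0 => // n _; elim: n => // n IH; rewrite expnS; lia.
have E8 : 0 < (8 : R) ^+ N by rewrite exprn_gt0.
have rho8 : rho * (8 ^+ N * c) <= 1 by rewrite -ler_pdivlMr // mulr_gt0.
have Nrho : N.+1%:R * rho * (4 * c) <= 1.
  apply: (@le_trans _ R _ _ _ _ rho8).
  have : rho * c * (N.+1%:R * 4) <= rho * c * 8 ^+ N.
    by rewrite ler_wpM2l // mulr_ge0 // ltW.
  lra.
have K_N : K.+1%:R <= N.+1%:R :> R by rewrite ler_nat.
have Krho : K.+1%:R * rho * (4 * c) <= 1.
  apply: (@le_trans _ R _ _ _ _ Nrho).
  by rewrite ler_wpM2r ?ler_wpM2r // ?mulr_ge0 // ltW.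
have r1 : rho < 1.
  have N1 : 1 <= K.+1%:R :> R by rewrite ler1n.
  have : 1 * rho * (4 * c) <= K.+1%:R * rho * (4 * c).
    by rewrite ler_wpM2r ?ler_wpM2r // ?mulr_ge0 // ltW.
  have : rho * (4 * 1) <= rho * (4 * c) by rewrite !ler_wpM2l.
  lra.
have bern n : 1 - n%:R * rho <= (1 - rho) ^+ n.
  elim: n => [|n IH]; first by rewrite mul0r subr0 expr0.
  have r10 : 0 <= 1 - rho by lra.
  have := ler_wpM2l r10 IH; rewrite -exprS -natr1.
  have : 0 <= n%:R * rho ^+ 2 by rewrite mulr_ge0 ?sqr_ge0.
  lra.
pose M := maxn (size f) K.+1.
have sM : (size f <= M)%N by rewrite leq_maxl.
have KM : (K < M)%N by rewrite leq_maxr.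
have t0 : t != [::] by rewrite -size_eq0 st.
have := hsym_dvd td sM; rewrite (bigD1 (Ordinal KM)) //= (hsym_size st) mulr1.
have := @hsym_sum R t rho M _ t0 tr; rewrite rho0 r1 st => /(_ isT).
rewrite (bigD1 (Ordinal KM)) //= (hsym_size st) cabs1.
set S := \sum_(i < M | _) cabs _; set T := \sum_(i < M | _) _ => S1 /eqP.
rewrite addr_eq0 => /eqP fT.
have : A <= c * A * S.
  rewrite -{1}fK fT cabsN; apply: (@le_trans _ R); first exact: cabs_sum.
  rewrite mulr_sumr; apply: ler_sum => k _.
  by rewrite cabsM ler_wpM2r ?cabs_ge0.
have -> : c * A * S = A * (c * S) by ring.
rewrite -{1}[A]mulr1 ler_pM2l // => cS.
have S0 : 0 <= S by apply: sumr_ge0 => k _; exact: cabs_ge0.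
have : (1 - K.+1%:R * rho) * (1 + S) <= 1.
  apply: (@le_trans _ R _ _ _ _ S1); rewrite ler_wpM2r ?bern //; lra.
have : (1 - K.+1%:R * rho) * (4 * c) >= 4 * c - 1 by lra.
set u := 1 - _ => h1 h2.
have u0 : 0 <= u.
  rewrite -(pmulr_lge0 _ (_ : 0 < 4 * c)) ?mulr_gt0 //; lra.
have : u * c * (1 + S) <= c by rewrite mulrAC -[leRHS]mul1r ler_wpM2r // ltW.
have : u * 1 <= u * (c * S) by rewrite ler_wpM2l.
move=> h3 h4.
(* From [c S >= 1] and [u (1 + S) <= 1]. Together with [4 c u >= 4 c - 1] it gives [3 c <= 1],
   against [c >= 1]. *)
have h5 : u * (c + 1) <= c by lra.
have h6 : (4 * c - 1) * (c + 1) <= u * (4 * c) * (c + 1) by rewrite ler_wpM2r //; lra.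
have h7 : 4 * c * (u * (c + 1)) <= 4 * c * c by rewrite ler_wpM2l //; lra.
lra.
Qed.

Lemma sum_expr2 n : \sum_(i < n) (2 : R) ^+ i = 2 ^+ n - 1.
Proof.
elim: n => [|n IH]; first by rewrite big_ord0 expr0 subrr.
by rewrite big_ord_recr IH /= exprS; ring.
Qed.

Lemma sum_exprV2 n : \sum_(i < n) (2 : R)^-1 ^+ i.+1 <= 1.
Proof.
suff -> : \sum_(i < n) (2 : R)^-1 ^+ i.+1 = 1 - 2^-1 ^+ n.
  by rewrite lerBlDr lerDl exprn_ge0 // invr_ge0.
elim: n => [|n IH]; first by rewrite big_ord0 expr0 subrr.
by rewrite big_ord_recr IH /= exprS; field.
Qed.

(** [B] bounds |f| on |z| = 1/2, and the n zeros make [T = B / (5/4)^n] a bound on |z| = 1/4.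
    Cauchy's estimate gives [|f_k| <= 4^k T], so in [B] the terms k <= N add up to less than
    [2^(N+1) T], and the tail to at most [c A 2^-N <= c 2^N T]. Dividing by [T] bounds [(5/4)^n]. *)
Lemma quarter_zeros_exp (f : {poly C}) (A c : R) (N K : nat) :
  (K <= N)%N -> 0 < A -> cabs f`_K = A -> 0 <= c ->
  (forall k, (N < k)%N -> cabs f`_k <= c * A) ->
  (5 / 4) ^+ nzeros f (1 / 4) <= 2 ^+ N * (2 + c).
Proof.
move=> KN A0 fK c0 fb.
have f0 : f != 0 by apply: contraTneq A0 => f0; rewrite -fK f0 coef0 cabs0 ltxx.
have [s [sr ss] [q fE]] := nzeros_split (1 / 4) f0.
pose M := (N.+1 + size f)%N.
pose B := \sum_(k < M) cabs f`_k * 2^-1 ^+ k.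
have h0 k : 0 <= (2 : R)^-1 ^+ k by rewrite exprn_ge0 // invr_ge0.
have KM : (K < M)%N by rewrite /M ltn_addr.
have B0 : 0 < B.
  rewrite /B (bigD1 (Ordinal KM)) //= ltr_pwDl //.
    by rewrite fK mulr_gt0 // exprn_gt0 // invr_gt0.
  by apply: sumr_ge0 => k _; rewrite mulr_ge0 ?cabs_ge0.
have fB z : cabs z = 1 / 2 -> cabs f.[z] <= B.
  move=> z2; rewrite (@horner_coef_wide _ M) ?leq_addl //.
  apply: (@le_trans _ R); first exact: cabs_sum.
  by apply: ler_sum => k _; rewrite cabsM cabsX z2 mul1r.
pose P := (5 / 4 : R) ^+ nzeros f (1 / 4).
have P0 : 0 < P by rewrite exprn_gt0.
pose T := B / P.
have T0 : 0 < T by rewrite divr_gt0.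
have fT x : cabs x = 1 / 4 -> cabs f.[x] <= T.
  move=> x4; rewrite /T ler_pdivlMr // mulrC /P -ss fE.
  by apply: zeros_contract; rewrite ?x4 // => z z2; rewrite -fE fB.
have fk k : cabs f`_k <= 4 ^+ k * T.
  have := @cauchy_estimate _ f (1 / 4) T _ T0 fT k.
  rewrite mul1r exprVn ler_pdivrMr ?exprn_gt0 // mulrC; apply.
  by rewrite invr_gt0.
have AT : A <= 4 ^+ N * T.
  rewrite -fK; apply: (@le_trans _ R _ _ _ (fk K)).
  by rewrite ler_wpM2r ?(ltW T0) // ler_weXn2l // ler1n.
have BE : B <= 2 ^+ N * (2 + c) * T.
  rewrite /B /M big_split_ord /=.
  have h1 : \sum_(i < N.+1) cabs f`_i * 2^-1 ^+ i <= (2 ^+ N.+1 - 1) * T.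
    rewrite -sum_expr2 mulr_suml; apply: ler_sum => i _.
    have -> : (2 : R) ^+ i = 4 ^+ i * 2^-1 ^+ i.
      by rewrite -exprMn; congr (_ ^+ _); field.
    by rewrite mulrAC ler_wpM2r.
  have h2 : \sum_(i < size f) cabs f`_(N.+1 + i) * 2^-1 ^+ (N.+1 + i) <= c * A * 2^-1 ^+ N.
    apply: (@le_trans _ R (c * A * 2^-1 ^+ N * \sum_(i < size f) 2^-1 ^+ i.+1)).
      rewrite mulr_sumr; apply: ler_sum => i _.
      by rewrite addSnnS exprD mulrA !ler_wpM2r // fb // addnS ltnS leq_addr.
    rewrite -[leRHS]mulr1 ler_wpM2l ?sum_exprV2 // mulr_ge0 // mulr_ge0 // ltW //.
  have h3 : c * A * 2^-1 ^+ N <= c * 2 ^+ N * T.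
    have -> : c * 2 ^+ N * T = c * (4 ^+ N * T) * 2^-1 ^+ N.
      have -> : (4 : R) = 2 * 2 by ring.
      rewrite exprMn exprVn; field; by rewrite expf_neq0.
    by rewrite ler_wpM2r // ler_wpM2l.
  have : 0 <= 2 ^+ N * T by rewrite mulr_ge0 ?exprn_ge0 // ltW.
  move: h1; rewrite exprS; lra.
move: BE; have -> : B = P * T by rewrite /T; field; rewrite gt_eqF.
by rewrite ler_pM2r.
Qed.

(** Source of the factor 5 in the zero bounds: [ln (4/5) <= -1/5]. *)
Lemma ln5_4 : (1 : R) <= 5 * ln (5 / 4).
Proof.
have := @le_ln1Dx R (- (1 / 5)).
have -> : 1 + - (1 / 5) = (5 / 4 : R)^-1 by field.
by rewrite lnV ?posrE // => /(_ _); lra.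
Qed.

Lemma quarter_zeros (f : {poly C}) (A c : R) (N K : nat) :
  (K <= N)%N -> 0 < A -> cabs f`_K = A -> 0 <= c ->
  (forall k, (N < k)%N -> cabs f`_k <= c * A) ->
  (nzeros f (1 / 4))%:R <= 5 * N%:R * ln 2 + 5 * ln (2 + c).
Proof.
move=> KN A0 fK c0 fb.
have := quarter_zeros_exp KN A0 fK c0 fb.
move: (nzeros _ _) => n H.
have c2 : 0 < 2 + c by lra.
have : ln ((5 / 4 : R) ^+ n) <= ln (2 ^+ N * (2 + c)).
  by rewrite ler_ln // posrE ?mulr_gt0 ?exprn_gt0.
rewrite lnM ?posrE ?exprn_gt0 // !lnXn // -[ln (5 / 4) *+ n]mulr_natl -[ln 2 *+ N]mulr_natl => H2.
have : n%:R * 1 <= n%:R * (5 * ln (5 / 4)) :> R by rewrite ler_wpM2l // ln5_4.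
lra.
Qed.

End Domination.

(** * Determinants of matrices indexed by a finite type *)

Section FinMatrix.
Variables (S : comNzRingType) (I : finType).

Definition finmx (M : I -> I -> S) : 'M[S]_#|I| :=
  \matrix_(i, j) M (enum_val i) (enum_val j).

Lemma big_enum_ord (T : Type) (z : T) (op : Monoid.com_law z) (F : I -> T) :
  \big[op/z]_(i : I) F i = \big[op/z]_(i < #|I|) F (enum_val i).
Proof.
rewrite (reindex (fun i : 'I_#|I| => enum_val i)) //=.
by exists enum_rank => i _; rewrite ?enum_rankK ?enum_valK.
Qed.

Lemma mul_finmx (M N : I -> I -> S) :
  finmx M *m finmx N = finmx (fun i j => \sum_k M i k * N k j).
Proof.
apply/matrixP => i j; rewrite !mxE big_enum_ord.
by apply: eq_bigr => k _; rewrite !mxE.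
Qed.

Lemma det_finmx_trig (M : I -> I -> S) (kap : I -> nat) : injective kap ->
  (forall i j, (kap j < kap i)%N -> M i j = 0) ->
  \det (finmx M) = \prod_i M i i.
Proof.
move=> ik M0; rewrite big_enum_ord.
rewrite (@det_trig_inj _ _ _ (fun i => kap (enum_val i))).
- by apply: eq_bigr => i _; rewrite mxE.
- by move=> i j /ik/enum_val_inj.
- by move=> i j lt; rewrite mxE M0.
Qed.

End FinMatrix.

(** * Zeros of combinations of polynomials bounded by 1 on the unit disc *)

Section FamilyZeros.
Variable R : realType.
Local Notation C := R[i].
Variables (I : finType) (g : I -> {poly C}) (kap : I -> nat).

Definition coef_minor : 'M[C]_#|I| :=
  finmx (fun j i => (g j)`_(kap i)).

Hypothesis kap_inj : injective kap.
Hypothesis g_le1 : forall i z, cabs z <= 1 -> cabs (g i).[z] <= 1.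

Let D := cabs (\det coef_minor).

Lemma coef_minor_row i : \sum_k `|coef_minor i k| ^+ 2 <= 1.
Proof.
under eq_bigr do rewrite mxE.
apply: parseval_le => [z z1|a b /kap_inj/enum_val_inj //].
by rewrite norm_le1 g_le1 // norm_eq1.
Qed.

(** Hadamard's inequality with rows of norm at most 1. It later ensures that the domination constant
    is at least 2. *)
Lemma cabs_minor_le1 : D <= 1.
Proof.
rewrite -norm_le1 -(expr_le1 (ltn0Sn 1)) //; apply: le_trans (hadamard _) _.
apply: prodr_ile1 => i _; rewrite coef_minor_row andbT.
by apply: sumr_ge0 => k _; rewrite exprn_ge0.
Qed.

Lemma lam_bound (lam : I -> C) (A : R) : 0 <= A ->
  (forall i, cabs (\sum_j lam j *: g j)`_(kap i) <= A) ->
  forall j, cabs (lam j) * D <= Num.sqrt #|I|%:R * A.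
Proof.
move=> A0 fA j.
pose v : 'rV[C]_#|I| := \row_i lam (enum_val i).
have vE k : (v *m coef_minor) 0 k = (\sum_j lam j *: g j)`_(kap (enum_val k)).
  rewrite mxE coef_sum [RHS]big_enum_ord.
  by apply: eq_bigr => i _; rewrite !mxE coefZ.
have := @cramer_bound _ _ coef_minor v (A%:C)%C.
move=> /(_ coef_minor_row); rewrite ler0c => /(_ A0).
have cA k : `|(v *m coef_minor) 0 k| <= (A%:C)%C by rewrite normE lecR vE.
move=> /(_ cA (enum_rank j)); rewrite mxE enum_rankK => H.
(* Squaring turns [sqrtC], which lives in the complex field, into a natural number, so that the
   inequality descends to [R]. *)
have {}H : (`|lam j| * `|\det coef_minor|) ^+ 2 <= (sqrtC #|I|%:R * (A%:C)%C) ^+ 2.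
  by apply: lerXn2r; rewrite ?nnegrE ?mulr_ge0 ?sqrtC_ge0 ?ler0c ?ler0n ?cabs_ge0.
move: H; rewrite [X in _ <= X -> _]exprMn sqrtCK !normE -(rmorph_nat (real_complex R)).
rewrite -!rmorphM -!rmorphXn -rmorphM lecR => H.
rewrite -(ler_pXn2r (ltn0Sn 1)) ?nnegrE ?mulr_ge0 ?sqrtr_ge0 ?cabs_ge0 //.
by rewrite [leRHS]exprMn sqr_sqrtr.
Qed.

(** Each coefficient of each [g j] has modulus at most 1 by Cauchy's estimate at radius 1. Summing
    over j multiplies the bound on [lam] by m, whence [m^(3/2)] in total. *)
Lemma coef_bound (lam : I -> C) (A : R) : 0 <= A ->
  (forall i, cabs (\sum_j lam j *: g j)`_(kap i) <= A) ->
  forall n, cabs (\sum_j lam j *: g j)`_n * D <= #|I|%:R * (Num.sqrt #|I|%:R * A).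
Proof.
move=> A0 fA n; have lb := lam_bound A0 fA.
apply: (@le_trans _ R (\sum_(j : I) (Num.sqrt #|I|%:R * A))); last first.
  by rewrite sumr_const mulr_natl.
apply: (@le_trans _ R ((\sum_j cabs (lam j)) * D)); last first.
  by rewrite mulr_suml; apply: ler_sum => j _; exact: lb.
rewrite ler_wpM2r ?cabs_ge0 // coef_sum; apply: (@le_trans _ R); first exact: cabs_sum.
apply: ler_sum => j _; rewrite coefZ cabsM -[leRHS]mulr1 ler_wpM2l ?cabs_ge0 //.
have := @cauchy_estimate _ (g j) 1 1 ltr01 ltr01 _ n.
by rewrite expr1n mulr1; apply=> z z1; rewrite g_le1 // z1.
Qed.

(** The first N+1 coefficients of [f] include all the columns [kap i], so their largest modulus [A]
    dominates every coefficient up to the factor c. The condition on c is squared to avoid a root of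
    [m^3]. The freedom in c' serves the small disc, where a constant at least 1 is required. *)
Lemma family_zeros (N : nat) (c : R) (lam : I -> C) :
  (0 < N)%N -> (forall i, (kap i <= N)%N) -> 0 < D ->
  0 <= c -> #|I|%:R ^+ 3 <= (c * D) ^+ 2 ->
  (exists j, lam j != 0) ->
  let f := \sum_j lam j *: g j in
  [/\ f != 0, (nzeros f (1 / 4))%:R <= 5 * N%:R * ln 2 + 5 * ln (2 + c)
    & forall c' rho, c <= c' -> 1 <= c' -> 0 <= rho -> rho <= 1 / (8 ^+ N * c') ->
      (nzeros f rho <= N)%N].
Proof.
move=> N0 kN D0 c0 cD [j lj] f.
pose K := [arg max_(k > (ord0 : 'I_N.+1)) cabs f`_k]%O.
pose A := cabs f`_K.
have fA (k : nat) : (k <= N)%N -> cabs f`_k <= A.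
  move=> kN'; rewrite /A /K; case: Order.TotalTheory.arg_maxP => //= i _ /(_ (Ordinal (kN' : (k < N.+1)%N))).
  by apply.
have A0 : 0 <= A by exact: cabs_ge0.
have fkA i : cabs f`_(kap i) <= A by apply: fA.
(* If [A] were 0, the Cramer bound would force every [lam j] to vanish. *)
have {}A0 : 0 < A.
  rewrite lt_def A0 andbT; apply/eqP => Az.
  have := lam_bound A0 fkA j; rewrite Az mulr0 leNgt.
  by rewrite mulr_gt0 // cabs_gt0.
have fn n : cabs f`_n <= c * A.
  rewrite -(ler_pM2r D0); apply: (@le_trans _ R _ _ _ (coef_bound (ltW A0) fkA n)).
  rewrite mulrA [leRHS]mulrAC ler_wpM2r ?(ltW A0) //.
  rewrite -(ler_pXn2r (ltn0Sn 1)) ?nnegrE ?mulr_ge0 ?sqrtr_ge0 ?(ltW D0) //.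
  by rewrite [leLHS]exprMn sqr_sqrtr // -exprSr.
have KN : (K <= N)%N by rewrite -ltnS.
split.
- by apply: contraTneq A0 => f0; rewrite /A f0 coef0 cabs0 ltxx.
- by apply: (@quarter_zeros R f A c N K) => // k _.
- move=> c' rho cc' c1 r0 rN; apply: (@few_zeros R f A c' rho N K) => // k.
  by apply: (@le_trans _ R _ _ _ (fn k)); rewrite ler_wpM2r // ltW.
Qed.

End FamilyZeros.

(** * The lacunary family *)

Section Family.
Variable L : lacunary.

Lemma Xexp_nth (j : idx L) : Xexp j = (nth 0 (T_ L (tag j)) (tagged j) - 1)%N.
Proof. by []. Qed.

Lemma t_range l i : (l <= ld L)%N -> (i < tau L l)%N ->
  (i < nth 0 (T_ L l) i <= (n_ L l).+1)%N.
Proof.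
move=> ll; elim: i => [|i IH] it.
  by have := T_range ll (mem_nth 0 it).
have /andP[_ ->] := T_range ll (mem_nth 0 it); rewrite andbT.
have /andP[lt _] := IH (ltnW it).
by apply: leq_ltn_trans lt _; apply: (sorted_ltn_nth ltn_trans 0 (T_sorted ll)) => //; rewrite ?inE // ltnW.
Qed.

Lemma t_mono l i j : (l <= ld L)%N -> (i < j)%N -> (j < tau L l)%N ->
  (nth 0 (T_ L l) i < nth 0 (T_ L l) j)%N.
Proof.
move=> ll ij jt; apply: (sorted_ltn_nth ltn_trans 0 (T_sorted ll)) => //; rewrite ?inE //.
exact: ltn_trans jt.
Qed.

Lemma tau_gt0 l : (l <= ld L)%N -> (0 < tau L l)%N.
Proof. by move=> ll; rewrite lt0n size_eq0 T_neq0. Qed.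

Lemma tau_le l : (l <= ld L)%N -> (tau L l <= (n_ L l).+1)%N.
Proof.
move=> ll; have t0 := tau_gt0 ll.
have := @t_range l (tau L l).-1 ll; rewrite ltn_predL t0 => /(_ isT).
by rewrite prednK // => /andP[+ +]; lia.
Qed.

Lemma n_mono l l' : (l' <= ld L)%N -> (l < l')%N -> (n_ L l < n_ L l')%N.
Proof.
elim: l' => // l' IH ll'; rewrite ltnS leq_eqVlt => /orP[/eqP->|lt].
  exact: n_incr.
by apply: ltn_trans (IH (ltnW ll') lt) _; exact: n_incr.
Qed.

Lemma n_le_deg l : (l <= ld L)%N -> (n_ L l <= lac_deg L)%N.
Proof. by rewrite leq_eqVlt => /orP[/eqP->//|lt]; apply: ltnW; apply: n_mono. Qed.

Lemma tag_le (j : idx L) : (tag j <= ld L)%N.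
Proof. by rewrite -ltnS. Qed.

Lemma Xexp_le (j : idx L) : (Xexp j <= n_ L (tag j))%N.
Proof.
have := t_range (tag_le j) (ltn_ord (tagged j)).
by rewrite Xexp_nth => /andP[_]; lia.
Qed.

Lemma Xexp_ge (j : idx L) : (tagged j <= Xexp j)%N.
Proof.
have := t_range (tag_le j) (ltn_ord (tagged j)).
by rewrite Xexp_nth => /andP[+ _]; lia.
Qed.

Lemma big_idx (T : Type) (z : T) (op : Monoid.com_law z) (F : nat -> nat -> T) :
  \big[op/z]_(j : idx L) F (tag j) (tagged j) =
  \big[op/z]_(l < (ld L).+1) \big[op/z]_(i < tau L l) F l i.
Proof.
by rewrite [RHS](sig_big_dep xpredT (fun=> xpredT)
  (fun (l : 'I_(ld L).+1) (i : 'I_(tau L l)) => F l i)).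
Qed.

Lemma card_idx : #|idx L| = lac_dim L.
Proof.
rewrite -sum1_card (eq_bigl xpredT) // (@big_idx _ _ _ (fun _ _ => 1%N)).
by apply: eq_bigr => l _; rewrite sum1_card card_ord.
Qed.

(** Since every t is at least 1 and [Xexp] is t - 1, the difference of [tbar] and m is the total
    exponent of [P1] in the product of all monomials. These sums become the exponents in the
    minors. *)
Lemma tbar_sum : tbar L = (\sum_(j : idx L) Xexp j + lac_dim L)%N.
Proof.
rewrite -card_idx -sum1_card -big_split /=.
transitivity (\sum_(j : idx L) nth 0 (T_ L (tag j)) (tagged j))%N.
  rewrite (@big_idx _ _ _ (fun l i => nth 0 (T_ L l) i)).
  by apply: eq_bigr => l _; rewrite big_add1 big_mkord.
apply: eq_bigr => j _; rewrite Xexp_nth.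
by have /andP[+ _] := t_range (tag_le j) (ltn_ord (tagged j)); lia.
Qed.

Lemma taunbar_sum : taunbar L = (\sum_(j : idx L) Xexp j + \sum_(j : idx L) Yexp j)%N.
Proof.
rewrite -big_split /=; transitivity (\sum_(j : idx L) n_ L (tag j))%N.
  rewrite (@big_idx _ _ _ (fun l i => n_ L l)).
  by apply: eq_bigr => l _; rewrite sum_nat_const card_ord.
by apply: eq_bigr => j _; rewrite /Yexp subnKC // Xexp_le.
Qed.

Lemma taubar'_sum : taubar' L = (\sum_(j : idx L) tagged j)%N.
Proof.
rewrite (@big_idx _ _ _ (fun l i => i)).
apply: eq_bigr => l _; rewrite -(big_mkord xpredT id) bin2_sum bin2 -divn2 //.
Qed.

Lemma taubar_sum : taubar L = (\sum_(j : idx L) tagged j + lac_dim L)%N.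
Proof.
rewrite -card_idx -sum1_card -big_split /=.
rewrite (@big_idx _ _ _ (fun l i => i + 1)%N).
apply: eq_bigr => l _; rewrite big_split /= sum1_card card_ord.
rewrite -(big_mkord xpredT id) bin2_sum bin2 -divn2.
case: (tau L l) => // t /=; have -> : (t.+1 * t.+2 = t.+1 * 2 + t.+1 * t)%N by lia.
by rewrite divnMDl // addnC.
Qed.

Lemma Xexp_inj_mono (i j : idx L) : tag i = tag j :> nat ->
  (tagged i < tagged j)%N -> (Xexp i < Xexp j)%N.
Proof.
move=> tij; rewrite !Xexp_nth; move: (nat_of_ord (tagged i)) => a lt; rewrite tij.
have lj : (tagged j < tau L (tag j))%N by [].
have := t_mono (tag_le j) lt lj; have := t_range (tag_le j) (ltn_trans lt lj).
by move=> /andP[+ _]; lia.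
Qed.

Lemma idx_eq (i j : idx L) : tag i = tag j :> nat -> tagged i = tagged j :> nat -> i = j.
Proof.
case: i => l i; case: j => l' j /= /val_inj ll; case: _ / ll j => j ij.
by congr existT; apply: val_inj.
Qed.

Lemma idx_inj (kap : idx L -> nat) :
  (forall i j : idx L, (tag i < tag j)%N -> kap i <> kap j) ->
  (forall i j : idx L, tag i = tag j :> nat -> (tagged i < tagged j)%N -> kap i <> kap j) ->
  injective kap.
Proof.
move=> h1 h2 i j e; case: (ltngtP (tag i) (tag j)) => [lt|lt|eq].
- by case: (h1 _ _ lt).
- by case: (h1 _ _ lt).
case: (ltngtP (tagged i) (tagged j)) => [lt|lt|eq'].
- by case: (h2 _ _ eq lt).
- by case: (h2 _ _ (esym eq) lt).
exact: idx_eq.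
Qed.

End Family.

Section Curve.
Variables (R : realType) (P1 P2 : {poly R[i]}) (L : lacunary).
Local Notation C := R[i].

Definition monomial (j : idx L) : {poly C} := P1 ^+ Xexp j * P2 ^+ Yexp j.

Lemma f_E (lam : {ffun idx L -> C}) :
  f_ P1 P2 lam = \sum_(j : idx L) lam j *: monomial j.
Proof.
rewrite /f_ /Q_ rmorph_sum horner_sum; apply: eq_bigr => j _.
rewrite rmorphM /= map_polyC map_polyXn /= hornerM hornerXn hornerC.
by rewrite comp_polyZ comp_Xn_poly -scalerAl.
Qed.

(** By default [sup] is 0 on a set without supremum. Hence [B1 = 1] forces the set to be nonempty
    and bounded, and then [sup] is an upper bound. *)
Lemma B1_le1 : B1 P1 P2 L = 1 -> forall j z, cabs z <= 1 -> cabs (monomial j).[z] <= 1.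
Proof.
move=> B1E j z z1; rewrite -[leRHS]B1E /B1.
set S := (X in sup X).
have hS : has_sup S.
  apply: contrapT => hS; move: B1E; rewrite /B1 -/S sup_out // => /esym/eqP.
  by rewrite oner_eq0.
apply: (ub_le_sup hS.2); exists z, j; split => //.
by rewrite /monomial hornerM !horner_exp.
Qed.

End Curve.

(** * Lowest-order terms at the origin *)

Section LowestCoef.
Variable C : fieldType.

(* [p] has no term below X^n and [c], possibly 0, is its coefficient of X^n. *)
Definition lowest (p : {poly C}) (n : nat) (c : C) :=
  (forall k, (k < n)%N -> p`_k = 0) /\ p`_n = c.

Lemma lowestM p q m n a b : lowest p m a -> lowest q n b ->
  lowest (p * q) (m + n) (a * b).
Proof.
move=> [p0 pm] [q0 qn]; split=> [k lt|].
  rewrite coefM big1 // => i _.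
  have [lti|lei] := ltnP i m; first by rewrite p0 ?mul0r.
  by rewrite q0 ?mulr0 //; have := ltn_ord i; lia.
have mn : (m < (m + n).+1)%N by rewrite ltnS leq_addr.
rewrite coefM (bigD1 (Ordinal mn)) //= addKn pm qn big1 ?addr0 // => i ni.
have [lti|lei] := ltnP i m; first by rewrite p0 ?mul0r.
rewrite q0 ?mulr0 //; move: ni; rewrite -val_eqE /= => ni.
by have := ltn_ord i; lia.
Qed.

Lemma lowestX p n a e : lowest p n a -> lowest (p ^+ e) (e * n) (a ^+ e).
Proof.
move=> lp; elim: e => [|e IH].
  by rewrite !expr0; split=> //; rewrite coef1.
by rewrite !exprS mulSn; exact: lowestM.
Qed.

Lemma lowest_nu (p : {poly C}) : p != 0 -> lowest p (mup 0 p) p`_(mup 0 p).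
Proof.
move=> p0; split=> // k lt.
have : ('X - 0%:P) ^+ (mup 0 p) %| p by rewrite -mup_geq.
rewrite subr0 => /dvdpP [q E].
by rewrite E coefMXn lt.
Qed.

Lemma coef_nu_neq0 (p : {poly C}) : p != 0 -> p`_(mup 0 p) != 0.
Proof.
move=> p0; apply/negP => /eqP pn.
suff : (mup 0 p < mup 0 p)%N by rewrite ltnn.
rewrite mup_geq // subr0; apply/dvdpP; exists (drop_poly (mup 0 p).+1 p).
rewrite -[LHS](poly_take_drop (mup 0 p).+1); suff -> : take_poly (mup 0 p).+1 p = 0 by rewrite add0r.
apply/polyP => k; rewrite coef_take_poly coef0 ltnS leq_eqVlt.
case: eqP => [->//|_ /=]; case: ltnP => // lt.
by case: (lowest_nu p0) => /(_ _ lt).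
Qed.

End LowestCoef.

Lemma chain_lt (N : nat) (lo hi : nat -> nat) :
  (forall l, (l <= N)%N -> (lo l <= hi l)%N) ->
  (forall l, (l < N)%N -> (hi l < lo l.+1)%N) ->
  forall l l', (l' <= N)%N -> (l < l')%N -> (hi l < lo l')%N.
Proof.
move=> lh hl l l'; elim: l' => // l' IH lN; rewrite ltnS leq_eqVlt => /orP[/eqP->|lt].
  exact: hl.
apply: leq_ltn_trans (hl _ lN); apply: leq_trans (lh _ (ltnW lN)).
by apply: ltnW; apply: IH => //; apply: ltnW.
Qed.

Lemma weight_le (a b x y n : nat) : (b <= a)%N -> (x <= y <= n)%N ->
  (x * a + (n - x) * b <= y * a + (n - y) * b)%N.
Proof.
move=> ba /andP[xy yn]; have [d ->] : exists d, a = (b + d)%N by exists (a - b)%N; lia.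
have -> : (x * (b + d) + (n - x) * b = n * b + x * d)%N by nia.
have -> : (y * (b + d) + (n - y) * b = n * b + y * d)%N by nia.
by rewrite leq_add2l leq_mul2r xy orbT.
Qed.

(** The weight is [n b + x (a - b)]: in a fixed degree n the weights lie in one arithmetic
    progression of step [a - b]. *)
Lemma weight_modn (a b x n : nat) : (b <= a)%N -> (x <= n)%N ->
  (x * a + (n - x) * b = n * b %[mod a - b])%N.
Proof.
move=> ba xn; have -> : (x * a + (n - x) * b = x * (a - b) + n * b)%N by nia.
by rewrite modnMDl.
Qed.

(** Provides the N > 0 required by [family_zeros]: two distinct indices cannot both be 0. *)
Lemma inj_bound_gt0 (I : finType) (kap : I -> nat) N : (2 <= #|I|)%N ->
  injective kap -> (forall i, (kap i <= N)%N) -> (0 < N)%N.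
Proof.
move=> I2 ik kN; rewrite lt0n; apply/eqP => N0.
move: I2; rewrite ltnNge => /negP; apply.
apply/card_le1P => i _ j; apply/esym/eqP; apply: ik.
by have := kN i; have := kN j; rewrite N0 !leqn0 => /eqP -> /eqP ->.
Qed.

(** * The minor for distinct multiplicities *)

Section DistinctMultiplicities.
Variables (R : realType) (P1 P2 : {poly R[i]}) (L : lacunary) (k : nat).
Local Notation C := R[i].
Hypotheses (P1_neq0 : P1 != 0) (P2_neq0 : P2 != 0).

Lemma nu_lt_size (P : {poly C}) : P != 0 -> (nu P <= (size P).-1)%N.
Proof.
move=> p0; have := coef_nu_neq0 p0; rewrite leqNgt; apply: contra => lt.
by rewrite nth_default // (leq_trans (leqSpred _) lt).
Qed.

(** Order of vanishing at 0 of the monomial j. *)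
Definition weight (j : idx L) := (Xexp j * nu P1 + Yexp j * nu P2)%N.

Lemma lowest_monomial (j : idx L) : lowest (monomial P1 P2 j) (weight j)
  (alpha_ P1 0 ^+ Xexp j * a_ P2 0 ^+ Yexp j).
Proof.
by rewrite /alpha_ /a_ !addn0; apply: lowestM; apply: lowestX; apply: lowest_nu.
Qed.

Hypothesis nu_le : (nu P2 <= nu P1)%N.

Lemma weight_bounds (j : idx L) :
  (nubar P1 P2 L (tag j) <= weight j <= nutilde P1 P2 L (tag j))%N.
Proof.
have lj := tag_le j; have tj := ltn_ord (tagged j).
have t0 := tau_gt0 lj; have tl : ((tau L (tag j)).-1 < tau L (tag j))%N by rewrite ltn_predL.
have mono i i' : (i <= i')%N -> (i' < tau L (tag j))%N ->
    (nth 0 (T_ L (tag j)) i <= nth 0 (T_ L (tag j)) i')%N.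
  rewrite leq_eqVlt => /orP[/eqP->//|lt it]; apply: ltnW; exact: t_mono.
rewrite /weight /Yexp Xexp_nth; apply/andP; split; apply: weight_le => //.
- rewrite leq_sub2r ?mono //=; have /andP[_ h] := t_range lj tj; rewrite leq_subLR add1n; exact: h.
- apply/andP; split; first by apply: leq_sub2r; apply: mono => //; rewrite -ltnS prednK.
  by have /andP[_ h] := t_range lj tl; rewrite /t_ leq_subLR add1n; exact: h.
Qed.

Lemma weight_le_max (j : idx L) : (weight j <= nutilde P1 P2 L (ell_neq P1 P2 L))%N.
Proof.
have /andP[_ h] := weight_bounds j; apply: leq_trans h _.
by rewrite /ell_neq; case: arg_maxnP => // i _ /(_ (tag j) isT).
Qed.

Hypothesis nu_neq : nu P1 <> nu P2.

(** Within one level the weight increases strictly with [Xexp], because [nu P2 < nu P1]. Across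
    levels, the first and third conditions separate the intervals of weights. Under the fifth, equal
    weights would make the two [nubar] congruent, and the intervals are then disjoint. *)
Lemma weight_inj : lacunarity P1 P2 L k -> injective weight.
Proof.
move=> lac; apply: idx_inj => i j; last first.
  move=> tij lt; have := Xexp_inj_mono tij lt; have := Xexp_le i; have := Xexp_le j.
  rewrite /weight /Yexp tij => h1 h2 h3.
  have nu_lt : (nu P2 < nu P1)%N by move: nu_le nu_neq; lia.
  nia.
move=> lt; have /andP[_ hi] := weight_bounds i; have /andP[lo _] := weight_bounds j.
have lj := tag_le j.
case: lac => [lac|[]//|[_ lac]|[[]//|[_ lac]]].
(* The weights of level l lie between [nu P2 * n_l] and [n_l * maxdeg]. *)
- have D1 : (nu P1 <= maxdeg P1 P2)%N by rewrite leq_max nu_lt_size.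
  have := chain_lt (N := ld L) (lo := fun l => (nu P2 * n_ L l)%N)
    (hi := fun l => (n_ L l * maxdeg P1 P2)%N) _ lac lj lt.
  have h1 : forall l, (l <= ld L)%N -> (nu P2 * n_ L l <= n_ L l * maxdeg P1 P2)%N.
    by move=> l _; rewrite mulnC leq_mul2l (leq_trans nu_le D1) orbT.
  move=> /(_ h1) h; apply/eqP; rewrite ltn_eqF //.
  apply: leq_ltn_trans (leq_trans h _); rewrite /weight /Yexp.
    by have := Xexp_le i; move: nu_le D1; nia.
  by have := Xexp_le j; move: nu_le; nia.
- have h1 : forall l, (l <= ld L)%N -> (nubar P1 P2 L l <= nutilde P1 P2 L l)%N.
    move=> l ll; have lt' : (l < (ld L).+1)%N by [].
    pose a : idx L := existT _ (Ordinal lt') (Ordinal (tau_gt0 ll)).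
    by have /andP[] := weight_bounds a; exact: leq_trans.
  have h := chain_lt h1 lac lj lt.
  by apply/eqP; rewrite ltn_eqF // (leq_ltn_trans hi) // (leq_trans h).
- move=> e; have := lac _ _ lj (tag_le i) lt.
  have md (a : idx L) : nubar P1 P2 L (tag a) = weight a %[mod nu P1 - nu P2].
    have h1 : (t_ L (tag a) 1 - 1 <= n_ L (tag a))%N.
      have := t_range (tag_le a) (tau_gt0 (tag_le a)); rewrite /t_ /=; lia.
    by rewrite /nubar /weight /Yexp !weight_modn // Xexp_le.
  rewrite !md -e => /(_ erefl); rewrite ltnNge => /negP; apply.
  by apply: leq_trans lo _; rewrite -e.
Qed.

(** A monomial has no term below its own weight, so the matrix is triangular for the order of the
    weights, with the lowest coefficients on the diagonal. *)
Lemma weight_minor : lacunarity P1 P2 L k ->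
  \det (coef_minor (@monomial R P1 P2 L) weight) =
  alpha_ P1 0 ^+ (tbar L - lac_dim L) * a_ P2 0 ^+ (taunbar L - (tbar L - lac_dim L)).
Proof.
move=> lac; rewrite /coef_minor (det_finmx_trig (weight_inj lac)) => [|i j lt].
  rewrite tbar_sum addnK taunbar_sum addKn -!prodrXr -big_split /=.
  by apply: eq_bigr => j _; case: (lowest_monomial j).
by case: (lowest_monomial i) => h _; exact: h.
Qed.

End DistinctMultiplicities.

(** * Curves with equal multiplicities *)

Lemma det_finmx_trig_tr (S : comNzRingType) (I : finType) (M : I -> I -> S)
  (kap : I -> nat) : injective kap ->
  (forall i j, (kap i < kap j)%N -> M i j = 0) ->
  \det (finmx M) = \prod_i M i i.
Proof.
move=> ik M0; rewrite -det_tr.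
rewrite -(@det_finmx_trig _ _ (fun i j => M j i) kap ik) => [|i j]; last exact: M0.
by congr (\det _); apply/matrixP => i j; rewrite !mxE.
Qed.

(** * Newton interpolation and binomial polynomials *)

Section Newton.
Variable F : fieldType.

Definition newton_poly (x : nat -> F) r : {poly F} := \prod_(j < r) ('X - (x j)%:P).

Lemma newton_polyS x r : newton_poly x r.+1 = newton_poly x r * ('X - (x r)%:P).
Proof. by rewrite /newton_poly big_ord_recr. Qed.

Lemma newton_poly_monic x r : newton_poly x r \is monic.
Proof. exact: monic_prod_XsubC. Qed.

Lemma size_newton_poly x r : size (newton_poly x r) = r.+1.
Proof. by rewrite /newton_poly size_prod_XsubC /index_enum -enumT size_enum_ord. Qed.

Lemma newton_expansion x n (p : {poly F}) : (size p <= n.+1)%N ->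
  exists d : nat -> F, [/\ d n = p`_n, (forall r, (n < r)%N -> d r = 0) &
    forall M, (n < M)%N -> p = \sum_(r < M) d r *: newton_poly x r].
Proof.
elim: n p => [|n IH] p sp.
  exists (fun r => if r == 0%N then p`_0 else 0); split=> [//|r|M M0].
    by case: r.
  rewrite (bigD1 (Ordinal M0)) //= big1 ?addr0 => [|i]; last first.
    by rewrite -val_eqE /= => /negPf ->; rewrite scale0r.
  by rewrite /newton_poly big_ord0 alg_polyC; exact: size1_polyC.
pose q := p - p`_n.+1 *: newton_poly x n.+1.
have nn : (newton_poly x n.+1)`_n.+1 = 1.
  by have /monicP := newton_poly_monic x n.+1; rewrite lead_coefE size_newton_poly.
have sq : (size q <= n.+1)%N.
  apply/leq_sizeP => j; rewrite leq_eqVlt => /orP[/eqP <-|lt].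
    by rewrite coefB coefZ nn mulr1 subrr.
  rewrite nth_default // (leq_trans (size_polyD _ _)) // geq_max size_polyN.
  by rewrite (leq_trans sp lt) (leq_trans (size_scale_leq _ _)) // size_newton_poly.
have [d [_ d0 dE]] := IH q sq.
exists (fun r => if r == n.+1 then p`_n.+1 else d r); split=> [|r nr|M nM].
- by rewrite eqxx.
- by rewrite gtn_eqF // d0 // ltnW.
have := dE M (ltnW nM); rewrite (bigD1 (Ordinal nM)) //= d0 // scale0r add0r => qE.
rewrite (bigD1 (Ordinal nM)) //= eqxx -[LHS](subrKC (p`_n.+1 *: newton_poly x n.+1)).
congr (_ + _); rewrite -/q qE; apply: eq_bigr => i.
by rewrite -val_eqE /= => /negPf ->.
Qed.

(** The polynomial [X (X-1) ... (X-s+1) / s!], which interpolates ['C(x, s)] in x. *)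
Definition binom_poly s : {poly F} := (s`!%:R)^-1 *: newton_poly (fun j => j%:R) s.

Lemma horner_newton_nat s x :
  (newton_poly (fun j => j%:R) s).[x%:R] = (x ^_ s)%:R :> F.
Proof.
elim: s => [|s IH]; first by rewrite /newton_poly big_ord0 hornerE.
rewrite newton_polyS hornerM IH hornerXsubC ffactnSr natrM.
(* For x < s the truncated difference is wrong, but the falling factorial is already 0. *)
have [sx|xs] := leqP s x; first by rewrite natrB.
by rewrite ffact_small // !mul0r.
Qed.

Lemma size_binom_poly s : (size (binom_poly s) <= s.+1)%N.
Proof. by rewrite (leq_trans (size_scale_leq _ _)) // size_newton_poly. Qed.

Lemma coef_binom_poly s : (binom_poly s)`_s = (s`!%:R)^-1.
Proof.
rewrite coefZ; have /monicP := newton_poly_monic (fun j => j%:R) s.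
by rewrite lead_coefE size_newton_poly => ->; rewrite mulr1.
Qed.

End Newton.

Lemma horner_binom_poly (F : numFieldType) s x :
  (binom_poly F s).[x%:R] = 'C(x, s)%:R.
Proof.
rewrite hornerZ horner_newton_nat -bin_ffact natrM mulrCA mulVf ?mulr1 //.
Qed.

(** * Contact of [P1] and [P2] at the origin *)

Section Contact.
Variables (R : realType) (P1 P2 : {poly R[i]}) (k : nat).
Local Notation C := R[i].
Hypotheses (P1_neq0 : P1 != 0) (P2_neq0 : P2 != 0).
Hypotheses (nu_eq : nu P1 = nu P2) (contact : is_contact_order P1 P2 k).

Lemma a0_neq0 : a_ P2 0 != 0.
Proof. by rewrite /a_ addn0; exact: coef_nu_neq0. Qed.

Lemma alpha0_neq0 : alpha_ P1 0 != 0.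
Proof. by rewrite /alpha_ addn0; exact: coef_nu_neq0. Qed.

Lemma mu_neq0 : mu P1 P2 != 0.
Proof. by rewrite mulf_neq0 ?invr_eq0 ?a0_neq0 ?alpha0_neq0. Qed.

Lemma delta_neq0 : delta P1 P2 k != 0.
Proof.
apply/negP; rewrite subr_eq0 => /eqP ak; case: contact => ag /(_ k.+1).
rewrite ltnn => H; suff : false by []; apply: H => i.
by rewrite leq_eqVlt => /orP[/eqP->//|]; exact: ag.
Qed.

(** Beyond both degrees the two coefficients in [delta] would be 0. This bound lets the first
    lacunarity condition control the steps of length k+1. *)
Lemma contact_lt_maxdeg : (nu P2 + k.+1 <= maxdeg P1 P2)%N.
Proof.
rewrite leqNgt; apply/negP => lt; have /eqP := delta_neq0; apply.
have h (P : {poly C}) : ((size P).-1 <= maxdeg P1 P2)%N -> P`_(nu P2 + k.+1) = 0.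
  by move=> h; rewrite nth_default // (leq_trans (leqSpred _)) // (leq_ltn_trans h).
rewrite /delta /alpha_ /a_ nu_eq !h ?mulr0 ?subrr //.
- by rewrite leq_maxr.
- by rewrite leq_maxl.
Qed.

Definition residual : {poly C} := P1 - mu P1 P2 *: P2.

Lemma lowest_residual : lowest residual (nu P2 + k.+1) (delta P1 P2 k).
Proof.
have [l1 _] := lowest_nu P1_neq0; have [l2 _] := lowest_nu P2_neq0.
split=> [i lt|]; rewrite coefB coefZ.
  have [lti|lei] := ltnP i (nu P2).
    by rewrite l1 -/(nu P1) ?nu_eq // l2 // mulr0 subrr.
  have [h _] := contact; have := h (i - nu P2)%N.
  rewrite /alpha_ /a_ nu_eq subnKC // => ->; first by rewrite subrr.
  by rewrite leq_subLR -ltnS -addnS.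
by rewrite /delta /alpha_ /a_ nu_eq.
Qed.

Definition mixed n s := residual ^+ s * P2 ^+ (n - s).

Lemma lowest_mixed n s : (s <= n)%N -> lowest (mixed n s)
  (nu P2 * n + k.+1 * s) (delta P1 P2 k ^+ s * a_ P2 0 ^+ (n - s)).
Proof.
move=> sn; have -> : (nu P2 * n + k.+1 * s = s * (nu P2 + k.+1) + (n - s) * nu P2)%N by nia.
apply: lowestM; apply: lowestX; first exact: lowest_residual.
by rewrite /a_ addn0; exact: lowest_nu.
Qed.

(** Binomial expansion of [P1 = mu P2 + residual]. Splitting [mu^(x-s)] as [mu^x mu^-s] leaves,
    apart from [mu^x], only ['C(x, s)] depending on x, and this is polynomial in x. *)
Lemma monomial_mixed n x : (x <= n)%N -> P1 ^+ x * P2 ^+ (n - x) =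
  \sum_(s < n.+1) (mu P1 P2 ^+ x * (mu P1 P2)^-1 ^+ s * 'C(x, s)%:R) *: mixed n s.
Proof.
move=> xn; have m0 := mu_neq0.
have P1E : P1 = mu P1 P2 *: P2 + residual by rewrite /residual addrC subrK.
rewrite {1}P1E exprDn mulr_suml.
rewrite (big_ord_widen_cond n.+1 xpredT
  (fun s => (mu P1 P2 *: P2) ^+ (x - s) * residual ^+ s *+ 'C(x, s) * P2 ^+ (n - x))) //.
rewrite big_mkcond; apply: eq_bigr => s _ /=; rewrite ltnS.
case: ifPn => [sx|]; last by rewrite -ltnNge => xs; rewrite bin_small // mulr0 scale0r.
rewrite /mixed; have -> : (n - s = (x - s) + (n - x))%N by lia.
rewrite exprZn exprD; have -> : mu P1 P2 ^+ x * (mu P1 P2)^-1 ^+ s = mu P1 P2 ^+ (x - s).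
  by rewrite -{1}(subnK sx) exprD exprVn mulfK // expf_neq0.
rewrite -scaler_nat -!scalerAl !scalerA [_%:R * _]mulrC; congr (_ *: _); ring.
Qed.

(* P1^x P2^(n-x) = mu^x sum_s 'C(x, s) mu^-s S^s P2^(n-s) with S the residual:
   Newton's expansion of the binomial polynomials at the nodes x 0, x 1, ...
   makes the coefficient of G r vanish at x i for i < r. *)
Lemma newton_basis (x : nat -> nat) (n : nat) : exists G : nat -> {poly C},
  (forall r, (r <= n)%N -> lowest (G r) (nu P2 * n + k.+1 * r)
     ((r`!%:R)^-1 * (mu P1 P2)^-1 ^+ r * (delta P1 P2 k ^+ r * a_ P2 0 ^+ (n - r))))
  /\ forall i tau, (i < tau <= n.+1)%N -> (x i <= n)%N ->
     P1 ^+ x i * P2 ^+ (n - x i) =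
     \sum_(r < tau) (mu P1 P2 ^+ x i * \prod_(j < r) ((x i)%:R - (x j)%:R)) *: G r.
Proof.
pose xc j : C := (x j)%:R.
have /choice[d dP] : forall s, exists d : nat -> C, [/\ d s = (s`!%:R)^-1,
    (forall r, (s < r)%N -> d r = 0) &
    forall M, (s < M)%N -> binom_poly _ s = \sum_(r < M) d r *: newton_poly xc r].
  by move=> s; rewrite -coef_binom_poly; apply: newton_expansion; exact: size_binom_poly.
(* The terms s < r vanish since [binom_poly s] has degree s, and those with s > r vanish to higher
   order at 0. So the lowest term comes from s = r, where [d r r = 1/r!]. *)
exists (fun r => \sum_(s < n.+1) (d s r * (mu P1 P2)^-1 ^+ s) *: mixed n s); split.
  move=> r rn; have rn' : (r < n.+1)%N by [].
  have z (s : 'I_n.+1) (j : nat) : (j < nu P2 * n + k.+1 * s)%N || (s < r)%N ->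
      ((d s r * (mu P1 P2)^-1 ^+ s) *: mixed n s)`_j = 0.
    move=> /orP[lt|lt]; last by case: (dP s) => _ -> //; rewrite mul0r scale0r coef0.
    by have [h _] := @lowest_mixed n s (ltn_ord s); rewrite coefZ h ?mulr0.
  split=> [j lt|]; rewrite coef_sum.
    apply: big1 => s _; apply: z; have [lt'|le] := ltnP s r; rewrite ?orbT // orbF.
    by apply: leq_trans lt _; rewrite leq_add2l leq_mul2l le orbT.
  rewrite (bigD1 (Ordinal rn')) //= big1 ?addr0.
    by rewrite coefZ; have [_ ->] := lowest_mixed rn; case: (dP r) => ->.
  move=> s; rewrite -val_eqE /= neq_ltn => /orP[lt|lt]; apply: z; rewrite ?lt ?orbT //.
  by rewrite ltn_add2l ltn_mul2l lt.
move=> i tau /andP[it tn] xn; rewrite (monomial_mixed xn).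
transitivity (\sum_(r < n.+1) (mu P1 P2 ^+ x i * \prod_(j < r) ((x i)%:R - (x j)%:R)) *:
  (\sum_(s < n.+1) (d s r * (mu P1 P2)^-1 ^+ s) *: mixed n s)).
  under [RHS]eq_bigr do rewrite scaler_sumr.
  rewrite exchange_big /=; apply: eq_bigr => s _.
  under eq_bigr do rewrite scalerA.
  rewrite -scaler_suml; congr (_ *: _).
  rewrite -horner_binom_poly; case: (dP s) => _ _ /(_ n.+1 (ltn_ord s)) ->.
  rewrite horner_sum mulr_sumr; apply: eq_bigr => r _.
  rewrite hornerZ; have -> : (newton_poly xc r).[(x i)%:R] = \prod_(j < r) ((x i)%:R - (x j)%:R).
    by rewrite horner_prod; apply: eq_bigr => j _; rewrite hornerXsubC.
  ring.
rewrite [RHS](big_ord_widen_cond n.+1 xpredT (fun r =>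
  (mu P1 P2 ^+ x i * \prod_(j < r) ((x i)%:R - (x j)%:R)) *:
  (\sum_(s < n.+1) (d s r * (mu P1 P2)^-1 ^+ s) *: mixed n s))) //.
rewrite [RHS]big_mkcond; apply: eq_bigr => r _ /=; case: ifPn => //; rewrite -leqNgt => tr.
(* For r > i the product over the nodes contains the factor j = i, which is 0; this truncates the
   sum at tau. *)
have ir : (i < r)%N by apply: leq_trans tr.
by rewrite (bigD1 (Ordinal ir)) //= subrr mul0r mulr0 scale0r.
Qed.

End Contact.

(** * The minor for equal multiplicities *)

Section EqualMultiplicities.
Variables (R : realType) (P1 P2 : {poly R[i]}) (L : lacunary) (k : nat).
Local Notation C := R[i].
Hypotheses (P1_neq0 : P1 != 0) (P2_neq0 : P2 != 0).
Hypotheses (nu_eq : nu P1 = nu P2) (contact : is_contact_order P1 P2 k).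
Local Notation muP := (mu P1 P2).

(** Order of vanishing at 0 of the Newton basis element with the same pair of indices. *)
Definition level (j : idx L) := (nu P2 * n_ L (tag j) + k.+1 * tagged j)%N.

Lemma nubar_eq l : (l <= ld L)%N -> nubar P1 P2 L l = (nu P2 * n_ L l)%N.
Proof.
move=> ll; rewrite /nubar nu_eq -mulnDl subnKC 1?mulnC //.
by have /andP[_ h] := t_range ll (tau_gt0 ll); rewrite /t_ leq_subLR add1n; exact: h.
Qed.

Lemma tagged_le (j : idx L) : (tagged j <= tau L (tag j) - 1)%N.
Proof. by rewrite -ltnS subn1 prednK // tau_gt0 // tag_le. Qed.

(** Levels with the same first index differ by multiples of k+1. For different first indices each
    condition separates the two ranges of levels, or makes them incongruent modulo k+1. Under the
    first condition this uses [tau - 1 <= n_l] and [nu P2 + k.+1 <= maxdeg]. *)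
Lemma level_inj : lacunarity P1 P2 L k -> injective level.
Proof.
move=> lac; apply: idx_inj => i j; last first.
  rewrite /level; move: (nat_of_ord (tagged i)) (nat_of_ord (tagged j)) => a b.
  by move=> -> lt /eqP; rewrite eqn_add2l eqn_pmul2l // ltn_eqF.
move=> lt; have lj := tag_le j; have li := tag_le i; have ti := tagged_le i.
have tn := tau_le li.
suff h : forall l l', (l' <= ld L)%N -> (l < l')%N ->
    (nu P2 * n_ L l + k.+1 * (tau L l - 1) < nu P2 * n_ L l')%N \/
    (nu P2 * n_ L l <> nu P2 * n_ L l' %[mod k.+1]).
  case: (h _ _ lj lt) => [{}h|{}h e].
    move=> e; have : (level i < level j)%N; last by rewrite e ltnn.
    apply: leq_ltn_trans (leq_trans h (leq_addr _ _)).
    by rewrite leq_add2l leq_mul2l ti orbT.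
  apply: h; have := congr1 (modn^~ k.+1) e.
  by rewrite /level /= ![(k.+1 * _)%N]mulnC ![(_ + _ * k.+1)%N]addnC !modnMDl.
case: lac => [lac|[_ lac]|[]//|[[_ lac]|[]//]] l l' ll' ltl.
- left; apply: leq_ltn_trans (_ : n_ L l * maxdeg P1 P2 < _)%N.
    have tl := tau_le (ltnW (leq_trans ltl ll')).
    apply: leq_trans (_ : n_ L l * (nu P2 + k.+1) <= _)%N.
      by rewrite mulnDr [(n_ L l * nu P2)%N]mulnC leq_add2l mulnC leq_mul2r leq_subLR add1n tl orbT.
    by rewrite leq_mul2l (contact_lt_maxdeg nu_eq contact) orbT.
  apply: (chain_lt (N := ld L) (lo := fun l => (nu P2 * n_ L l)%N)) lac _ _ ll' ltl => l1 _.
  rewrite mulnC leq_mul2l (leq_trans _ (contact_lt_maxdeg nu_eq contact)) ?orbT //.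
  exact: leq_addr.
- left; apply: (chain_lt (N := ld L) (lo := fun l => (nu P2 * n_ L l)%N)
     (hi := fun l => (nu P2 * n_ L l + k.+1 * (tau L l - 1))%N)) lac _ _ ll' ltl => l1 _.
  exact: leq_addr.
- have ll := ltnW (leq_trans ltl ll').
  have := lac _ _ ll' ll ltl; rewrite !nubar_eq // => {}lac.
  by have [e|ne] := eqVneq (nu P2 * n_ L l' %% k.+1)%N (nu P2 * n_ L l %% k.+1)%N;
    [left; apply: lac | right => e; rewrite e eqxx in ne].
Qed.

(** Maximality of [ell_eq] is stated with [k.+1 * tau]; removing one k+1 from both sides is safe
    because every tau is positive. *)
Lemma level_le_max (j : idx L) :
  (level j <= nu P2 * n_ L (ell_eq P1 P2 L k) + k.+1 * (tau L (ell_eq P1 P2 L k) - 1))%N.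
Proof.
clear P1_neq0 P2_neq0.
rewrite /ell_eq; case: arg_maxnP => // e _ /(_ (tag j) isT).
have le : (e <= ld L)%N by rewrite -ltnS.
rewrite !nubar_eq ?tag_le // /level => h; have := tagged_le j.
have := tau_gt0 (tag_le j); have := tau_gt0 le; move: h.
set a := (nu P2 * _)%N; set b := (nu P2 * _)%N; move: (tau L (tag j)) (tau L e) (nat_of_ord (tagged j)).
move=> t t' s h t'0 t0 st.
have : (k.+1 * s + k.+1 <= k.+1 * t)%N by rewrite -mulnSr leq_mul2l; lia.
have : (k.+1 * t' = k.+1 * (t' - 1) + k.+1)%N by rewrite -mulnSr; congr (_ * _)%N; lia.
by lia.
Qed.

Lemma cabs_nodes l i : (l <= ld L)%N -> (i < tau L l)%N ->
  \prod_(j < i) cabs ((nth 0%N (T_ L l) i - 1)%N%:R - (nth 0%N (T_ L l) j - 1)%N%:R : C) =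
  \prod_(1 <= j < i.+1) ((t_ L l i.+1)%:R - (t_ L l j)%:R) :> R.
Proof.
move=> ll it; rewrite big_add1 big_mkord; apply: eq_bigr => j _.
have jt := ltn_trans (ltn_ord j) it.
have lt := t_mono ll (ltn_ord j) it.
have /andP[j0 _] := t_range ll jt.
have j1 := leq_ltn_trans (leq0n _) j0.
by rewrite /t_ /= -!natrB ?cabs_nat //; [congr (_%:R); lia | exact: ltnW | exact: leq_sub2r (ltnW lt)].
Qed.

Lemma Cbar_idx : Cbar L R = \prod_(j : idx L)
  ((\prod_(1 <= j' < (tagged j).+1) ((t_ L (tag j) (tagged j).+1)%:R - (t_ L (tag j) j')%:R))
     / ((tagged j)`!)%:R).
Proof.
rewrite (@big_idx L _ _ _ (fun l i => (\prod_(1 <= j' < i.+1)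
   ((t_ L l i.+1)%:R - (t_ L l j')%:R)) / i`!%:R)).
by apply: eq_bigr => l _; rewrite big_add1 big_mkord.
Qed.

(** The minor factors as [A H]. [A] expresses the monomials in the Newton basis and is triangular
    inside each degree block. [H] holds the coefficients of that basis and is triangular because its
    elements vanish to distinct orders. The node differences of [A] and the factorials of [H] form
    [Cbar]. *)
Lemma cabs_level_minor : lacunarity P1 P2 L k ->
  cabs (\det (coef_minor (@monomial R P1 P2 L) level)) =
  Cbar L R * cabs muP ^+ (tbar L - taubar L)
    * cabs (a_ P2 0) ^+ (taunbar L - taubar' L)
    * cabs (delta P1 P2 k) ^+ taubar' L.
Proof.
move=> lac; have m0 := mu_neq0 P1_neq0 P2_neq0.
pose x l i := (nth 0 (T_ L l) i - 1)%N.
have /choice[G GP] := fun l => newton_basis P1_neq0 P2_neq0 nu_eq contact (x l) (n_ L l).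
pose A (i j : idx L) : C := if (tag i == tag j :> nat) then
   muP ^+ x (tag j) (tagged i) *
   \prod_(s < tagged j) ((x (tag j) (tagged i))%:R - (x (tag j) s)%:R) else 0.
pose H (i j : idx L) : C := (G (tag i) (tagged i))`_(level j).
have tj (j : idx L) : (tagged j <= n_ L (tag j))%N.
  by have := tagged_le j; have := tau_le (tag_le j); lia.
have -> : coef_minor (@monomial R P1 P2 L) level = finmx A *m finmx H.
  rewrite mul_finmx; apply/matrixP => a b; rewrite !mxE.
  move: (enum_val a) (enum_val b) => i j {a b}.
  have [_ /(_ (tagged i) (tau L (tag i)))] := GP (tag i).
  rewrite ltn_ord tau_le ?tag_le // => /(_ isT (Xexp_le i)) E.
  rewrite (E : monomial P1 P2 i = _) coef_sum.
  rewrite (@big_idx L _ _ _ (fun l r => (if tag i == l :> nat then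
     muP ^+ x l (tagged i) * \prod_(s < r) ((x l (tagged i))%:R - (x l s)%:R) else 0)
     * (G l r)`_(level j))).
  rewrite (bigD1 (tag i)) //= [X in _ + X]big1 ?addr0 => [|l ne]; last first.
    apply: big1 => r _; case: eqP => [e|_]; last by rewrite mul0r.
    by move/eqP: ne; case; apply: val_inj; exact: esym e.
  by apply: eq_bigr => r _; rewrite eqxx coefZ.
have lv (i j : idx L) : (level i < level j)%N -> tag i = tag j :> nat -> (tagged i < tagged j)%N.
  rewrite /level; move: (nat_of_ord (tagged i)) (nat_of_ord (tagged j)) => a b + e.
  by rewrite e ltn_add2l ltn_pmul2l.
have li := level_inj lac.
rewrite det_mulmx (det_finmx_trig_tr li) => [|i j lt]; last first.
  rewrite /A; case: eqP => // e; have ij := lv _ _ lt e.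
  by rewrite (bigD1 (Ordinal ij)) //= subrr mul0r mulr0.
rewrite (det_finmx_trig li) => [|i j lt]; last first.
  by case: (GP (tag i)) => /(_ _ (tj i)) [h _] _; exact: h.
rewrite -big_split cabs_prod Cbar_idx.
(* The truncated differences may be taken termwise because [tagged j <= Xexp j]. *)
have -> : (tbar L - taubar L = \sum_(j : idx L) (Xexp j - tagged j))%N.
  rewrite sumnB => [|j _]; last exact: Xexp_ge.
  by rewrite tbar_sum taubar_sum; lia.
have -> : (taunbar L - taubar' L = \sum_(j : idx L) (n_ L (tag j) - tagged j))%N.
  rewrite sumnB => [|j _]; last exact: tj.
  rewrite taubar'_sum taunbar_sum -big_split /=; congr (_ - _)%N.
  by apply: eq_bigr => j _; rewrite /Yexp subnKC // Xexp_le.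
rewrite taubar'_sum -!prodrXr -!big_split; apply: eq_bigr => j _ /=.
rewrite /A /H eqxx; case: (GP (tag j)) => /(_ _ (tj j)) [_ ->] _.
have c0 : cabs muP != 0 by rewrite cabs_eq0.
move: muP c0 => m c0.
rewrite !cabsM cabs_prod !cabsX !cabsV cabs_nat -cabs_nodes ?tag_le //.
have -> : cabs m ^+ x (tag j) (tagged j) = cabs m ^+ (Xexp j - tagged j) * cabs m ^+ tagged j.
  by rewrite -exprD subnK // Xexp_ge.
rewrite exprVn; field.
by rewrite expf_neq0 //= pnatr_eq0 -lt0n fact_gt0.
Qed.

End EqualMultiplicities.

(** * Growth of the bounds *)

(** A real bound on the zero counts makes the set of attained counts finite, so the maximum
    exists. *)
Lemma max_nzeros (R : realType) (P1 P2 : {poly R[i]}) (L : lacunary) (rho b : R) :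
  (exists lam : {ffun idx L -> R[i]}, f_ P1 P2 lam != 0) ->
  (forall lam : {ffun idx L -> R[i]}, f_ P1 P2 lam != 0 ->
     (nzeros (f_ P1 P2 lam) rho)%:R <= b) ->
  exists2 Z, is_max_nzeros P1 P2 L rho Z & Z%:R <= b.
Proof.
move=> [lam0 f0] bd.
pose P n := `[< exists2 lam : {ffun idx L -> R[i]},
  f_ P1 P2 lam != 0 & nzeros (f_ P1 P2 lam) rho = n >].
have exP : exists n, P n by exists (nzeros (f_ P1 P2 lam0) rho); apply/asboolP; exists lam0.
have b0 : 0 <= b by apply: le_trans (bd _ f0); rewrite ler0n.
have ubP n : P n -> (n <= Num.bound b)%N.
  move=> /asboolP[lam fl <-]; rewrite -(ler_nat R); apply: le_trans (bd _ fl) _.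
  exact/ltW/archi_boundP.
case: (ex_maxnP exP ubP) => Z /asboolP[lam fl zZ] Zmax.
exists Z; last by rewrite -zZ bd.
split; first by exists lam.
by move=> lam' fl'; apply: Zmax; apply/asboolP; exists lam'.
Qed.

Section Sizes.
Variable L : lacunary.

Lemma ld_le_deg : (ld L <= lac_deg L)%N.
Proof.
suff h l : (l <= ld L)%N -> (l <= n_ L l)%N by exact: h.
elim: l => // l IH ll; apply: leq_ltn_trans (IH (ltnW ll)) _; exact: n_incr.
Qed.

Lemma lac_dim_le : (lac_dim L <= (lac_deg L).+1 * (lac_deg L).+1)%N.
Proof.
apply: leq_trans (_ : (\sum_(l < (ld L).+1) (lac_deg L).+1) <= _)%N.
  apply: leq_sum => l _; have ll : (l <= ld L)%N by rewrite -ltnS.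
  by apply: leq_trans (tau_le ll) _; rewrite ltnS n_le_deg.
by rewrite sum_nat_const card_ord leq_mul2r ltnS ld_le_deg orbT.
Qed.

Lemma lac_deg_gt0 : (2 <= lac_dim L)%N -> (0 < lac_deg L)%N.
Proof. by move=> m2; have := leq_trans m2 lac_dim_le; case: (lac_deg L). Qed.

Lemma sum_idx_le (F : idx L -> nat) : (forall j, (F j <= n_ L (tag j))%N) ->
  (\sum_j F j <= lac_deg L * lac_dim L)%N.
Proof.
move=> Fn; rewrite -card_idx mulnC -sum_nat_const; apply: leq_sum => j _.
by apply: leq_trans (Fn j) _; rewrite n_le_deg // tag_le.
Qed.

Lemma tbar_sub_le : (tbar L - lac_dim L <= lac_deg L * lac_dim L)%N.
Proof. by rewrite tbar_sum addnK; apply: sum_idx_le => j; exact: Xexp_le. Qed.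

Lemma taunbar_le : (taunbar L <= lac_deg L * lac_dim L)%N.
Proof.
rewrite taunbar_sum -big_split; apply: sum_idx_le => j /=.
by rewrite /Yexp subnKC // Xexp_le.
Qed.

Lemma taubar'_le : (taubar' L <= lac_deg L * lac_dim L)%N.
Proof.
rewrite taubar'_sum; apply: sum_idx_le => j; apply: leq_trans (Xexp_ge j) _.
exact: Xexp_le.
Qed.

Lemma tbar_taubar_le : (tbar L - taubar L <= lac_deg L * lac_dim L)%N.
Proof. by apply: leq_trans tbar_sub_le; rewrite taubar_sum addnC subnDA leq_subr. Qed.

(** Increasing integers satisfy [t_i - t_j >= i - j], so each product of differences is at least the
    factorial dividing it. *)
Lemma Cbar_ge1 (R : realType) : 1 <= Cbar L R.
Proof.
rewrite /Cbar; elim/big_ind: _ => // [x y x1 y1|l _].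
  by rewrite -[1]mulr1 ler_pM.
have ll : (l <= ld L)%N by rewrite -ltnS.
rewrite big_add1 big_mkord; elim/big_ind: _ => // [x y x1 y1|i _].
  by rewrite -[1]mulr1 ler_pM.
rewrite ler_pdivlMr ?ltr0n ?fact_gt0 // mul1r big_add1 big_mkord.
rewrite -ffactnn ffact_prod natr_prod; apply: ler_prod => j _.
rewrite ler0n /=; have it := ltn_ord i; have ji := ltn_ord j.
have h a : (a + j < tau L l)%N -> (nth 0 (T_ L l) j + a <= nth 0 (T_ L l) (a + j))%N.
  elim: a => [|a IH] aj; first by rewrite addn0.
  rewrite addnS; apply: leq_ltn_trans (IH (ltnW aj)) _; exact: t_mono.
have := h (i - j)%N; rewrite subnK ?(ltnW ji) // => /(_ it) => hh.
rewrite /t_ /= -natrB; last by apply: leq_trans hh; rewrite leq_addr.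
by rewrite ler_nat leq_subRL ?(leq_trans _ hh) // leq_addr.
Qed.

End Sizes.

(** * Logarithmic estimates *)

Section Bounds.
Variable R : realType.

(** A real power, since m+1 may be odd. *)
Definition halfpow (m : nat) : R := m%:R `^ (m.+1%:R / 2).

Lemma sqr_halfpow m : halfpow m ^+ 2 = m%:R ^+ m.+1.
Proof.
rewrite /halfpow -powR_mulrn ?powR_ge0 // -powRrM divfK //.
by rewrite powR_mulrn.
Qed.

Lemma halfpow_gt0 m : (0 < m)%N -> 0 < halfpow m.
Proof. by move=> m0; rewrite powR_gt0 // ltr0n. Qed.

(** Allows the [m^(3/2)] of the Cramer argument to be replaced by [m^((m+1)/2)], as m+1 >= 3. *)
Lemma cube_le_halfpow m : (2 <= m)%N -> m%:R ^+ 3 <= halfpow m ^+ 2.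
Proof.
by move=> m2; rewrite sqr_halfpow ler_weXn2l // ler1n; lia.
Qed.

Lemma halfpow_ge2 m : (2 <= m)%N -> 2 <= halfpow m.
Proof.
move=> m2; rewrite -(ler_pXn2r (ltn0Sn 1)) ?nnegrE ?powR_ge0 //.
apply: le_trans (cube_le_halfpow m2).
apply: le_trans (_ : 2 ^+ 3 <= _); first by rewrite ler_weXn2l // ler1n.
by rewrite lerXn2r ?nnegrE // ler_nat.
Qed.

Lemma ln_halfpow m : ln (halfpow m) = m.+1%:R / 2 * ln m%:R.
Proof. exact: ln_powR. Qed.

Lemma ln_nat_le1 (x : R) : 0 <= x -> ln (1 + x) <= x.
Proof. by move=> x0; apply: le_ln1Dx; lra. Qed.

Lemma ln2_le1 : ln (2 : R) <= 1.
Proof. by have -> : (2 : R) = 1 + 1 by []; exact: ln_nat_le1. Qed.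

Lemma ln_lac_dim (L : lacunary) : (2 <= lac_dim L)%N ->
  ln ((lac_dim L)%:R : R) <= 2 * (lac_deg L)%:R.
Proof.
move=> m2; apply: le_trans (_ : ln (((lac_deg L).+1%:R : R) ^+ 2) <= _).
  rewrite ler_ln ?posrE ?exprn_gt0 ?ltr0n //; last by lia.
  by rewrite -natrX ler_nat lac_dim_le.
rewrite lnXn ?ltr0n // -[leLHS]mulr_natl ler_wpM2l //.
by rewrite -natr1 addrC; apply: ln_nat_le1.
Qed.

Lemma ln_halfpow_le (L : lacunary) : (2 <= lac_dim L)%N ->
  ln (halfpow (lac_dim L)) <= 2 * (lac_deg L * lac_dim L)%:R.
Proof.
move=> m2; rewrite ln_halfpow; have h := ln_lac_dim m2.
have m1 : 1 <= (lac_dim L)%:R :> R by rewrite ler1n; lia.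
have d0 : 0 <= (lac_deg L)%:R :> R by [].
have l0 : 0 <= ln ((lac_dim L)%:R : R) by exact: ln_ge0.
rewrite natrM -natr1; move: m1 h d0 l0; set m := (lac_dim L)%:R; set d := (lac_deg L)%:R.
set l := ln m => m1 h d0 l0.
have : (m + 1) * l <= (m + m) * l by rewrite ler_wpM2r // lerD2l.
have : m * l <= m * (2 * d) by rewrite ler_wpM2l //; lra.
lra.
Qed.

(** Both 1 and 1/c are at most [exp S], so the argument of [ln] is at most [4 X exp S], and
    [ln 4 <= 2]. *)
Lemma ln_dominated (X c S : R) : 1 <= X -> 0 < c -> 0 <= S -> - ln c <= S ->
  ln (2 + 4 * X / (3 * c)) <= 2 + ln X + S.
Proof.
move=> X1 c0 S0 cS.
have e1 : 1 <= expR S by rewrite -expR0 ler_expR.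
have ce : c^-1 <= expR S.
  by rewrite -[c^-1]lnK ?posrE ?invr_gt0 // ler_expR lnV ?posrE.
have X0 : 0 < X by lra.
have x0 : 0 < 2 + 4 * X / (3 * c) by rewrite addr_gt0 // divr_gt0 // mulr_gt0.
have -> : 2 + ln X + S = 2 + ln (X * expR S) by rewrite lnM ?posrE ?expR_gt0 // expRK addrA.
apply: le_trans (_ : ln (2 ^+ 2 * (X * expR S)) <= _); last first.
  rewrite lnM ?posrE ?mulr_gt0 ?expR_gt0 ?exprn_gt0 // lerD2r lnXn //.
  by rewrite -[leLHS]mulr_natl; have := ln2_le1; lra.
rewrite ler_ln ?posrE ?mulr_gt0 ?expR_gt0 ?exprn_gt0 //.
have -> : 4 * X / (3 * c) = 4 / 3 * (X * c^-1) by field; rewrite gt_eqF.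
have h1 : X * c^-1 <= X * expR S by rewrite ler_wpM2l // ltW.
have h2 : 1 * 1 <= X * expR S by rewrite ler_pM.
lra.
Qed.

Lemma mulrn_ln_le (n M : nat) (x : R) : (n <= M)%N ->
  n%:R * ln x <= M%:R * `|ln x| /\ - (n%:R * ln x) <= M%:R * `|ln x|.
Proof.
move=> nM; have h : n%:R * `|ln x| <= M%:R * `|ln x| by rewrite ler_wpM2r // ler_nat.
split; apply: le_trans h; first by rewrite ler_wpM2l // ler_norm.
by rewrite -mulrN ler_wpM2l // -normrN ler_norm.
Qed.

End Bounds.

Lemma ffun_neq0 (I : finType) (V : nmodType) (lam : {ffun I -> V}) :
  lam != 0 -> exists j, lam j != 0.
Proof.
move=> l0; apply/existsP; apply: contraR l0; rewrite negb_exists => /forallP h.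
by apply/eqP/ffunP => j; rewrite ffunE; apply/eqP; have := h j; rewrite negbK.
Qed.

(** * Zero counts and their growth in the two cases *)

Section CaseBounds.
Variables (R : realType) (P1 P2 : {poly R[i]}) (L : lacunary) (k : nat).
Local Notation C := R[i].
Hypotheses (P1_neq0 : P1 != 0) (P2_neq0 : P2 != 0) (nu_gt0 : (0 < nu P2)%N).
Hypotheses (m2 : (2 <= lac_dim L)%N) (B1_eq1 : B1 P1 P2 L = 1).
Hypothesis lac : lacunarity P1 P2 L k.
Local Notation m := (lac_dim L).
Local Notation X := (halfpow R m).
Local Notation A0 := (cabs (alpha_ P1 0)).
Local Notation A2 := (cabs (a_ P2 0)).

Lemma exists_f_neq0 :
  (forall lam : {ffun idx L -> C}, lam != 0 -> f_ P1 P2 lam != 0) ->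
  exists lam : {ffun idx L -> C}, f_ P1 P2 lam != 0.
Proof.
move=> h; have /card_gt0P[j _] : (0 < #|idx L|)%N by rewrite card_idx ltnW.
exists [ffun=> 1]; apply: h; apply/eqP => /ffunP/(_ j); rewrite !ffunE => /eqP.
by rewrite oner_eq0.
Qed.

Lemma lam_neq0 (lam : {ffun idx L -> C}) : f_ P1 P2 lam != 0 -> lam != 0.
Proof.
apply: contraNneq => ->; rewrite f_E big1 // => j _.
by rewrite ffunE scale0r.
Qed.

Let X0 : 0 < X. Proof. by apply: halfpow_gt0; exact: ltnW. Qed.
Let X2 : 2 <= X. Proof. exact: halfpow_ge2. Qed.

(** [family_zeros] at the weights, with domination constant [X / c]. As this is at least 2,
    [2 + X / c <= 2 X / c]; the extra [ln 2] turns N into N+1. The factor 3/4 in the radius is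
    slack. *)
Lemma zeros_neq : (nu P2 <= nu P1)%N -> nu P1 <> nu P2 ->
  let N := nutilde P1 P2 L (ell_neq P1 P2 L) in
  let c := A0 ^+ (tbar L - m) * A2 ^+ (taunbar L - (tbar L - m)) in
  forall lam : {ffun idx L -> C}, lam != 0 ->
  [/\ f_ P1 P2 lam != 0,
    (nzeros (f_ P1 P2 lam) (1 / 4))%:R <=
      5 * N.+1%:R * ln 2 + 5 / 2 * m.+1%:R * ln m%:R
      + 5 * (tbar L - m)%:R * ln (1 / A0)
      + 5 * (taunbar L - (tbar L - m))%:R * ln (1 / A2)
    & (nzeros (f_ P1 P2 lam) (3 / (4 * 8 ^+ N) * (c / X)) <= N)%N].
Proof.
move=> nu_le nu_neq N c lam /ffun_neq0 l0.
have g1 := B1_le1 B1_eq1.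
have wi := weight_inj P1_neq0 P2_neq0 nu_le nu_neq lac.
have wN := @weight_le_max R P1 P2 L nu_le.
have DE := weight_minor P1_neq0 P2_neq0 nu_le nu_neq lac.
have N0 : (0 < N)%N by apply: (inj_bound_gt0 _ wi wN); rewrite card_idx.
have A00 : 0 < A0 by rewrite cabs_gt0 alpha0_neq0.
have A20 : 0 < A2 by rewrite cabs_gt0 a0_neq0.
have c0 : 0 < c by rewrite mulr_gt0 ?exprn_gt0.
have cE : c = cabs (\det (coef_minor (@monomial R P1 P2 L) (@weight R P1 P2 L))).
  by rewrite DE cabsM !cabsX.
have c1 : c <= 1 by rewrite cE; exact: cabs_minor_le1.
have Xc : 2 <= X / c by rewrite ler_pdivlMr //; move: c1 X2; lra.
have := @family_zeros R _ _ _ wi g1 N (X / c) lam N0 wN.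
rewrite -cE card_idx divfK ?gt_eqF // -f_E => /(_ c0).
case=> [||//|f0 zq zr]; first by lra.
  exact: cube_le_halfpow.
split=> //; last first.
  clearbody c N; apply: (zr (X / c)) => //; first by move: Xc; lra.
    by rewrite mulr_ge0 ?divr_ge0 ?mulr_ge0 ?exprn_ge0 // ltW.
  have -> : 3 / (4 * 8 ^+ N) * (c / X) = 3 / 4 * (1 / (8 ^+ N * (X / c))).
    by field; rewrite !gt_eqF ?exprn_gt0.
  rewrite -[leRHS]mul1r ler_wpM2r ?divr_ge0 ?mulr_ge0 ?exprn_ge0 ?invr_ge0 ?(ltW X0) ?(ltW c0) //; lra.
apply: le_trans zq _.
have : ln (2 + X / c) <= ln (2 * (X / c)).
  by rewrite ler_ln ?posrE; lra.
rewrite lnM ?posrE ?divr_gt0 // ln_div ?posrE // ln_halfpow.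
rewrite {2}/c lnM ?posrE ?exprn_gt0 // !lnXn //.
rewrite -[ln A0 *+ _]mulr_natl -[ln A2 *+ _]mulr_natl.
rewrite !div1r !lnV ?posrE // -natr1; lra.
Qed.

(** [family_zeros] at the levels, with constant [4 X / (3 c)]. The largest level [N], and not only
    [nu P2 * n_ L e], is both the exponent of 8 and the number of zeros allowed in the small
    disc. *)
Lemma zeros_eq : nu P1 = nu P2 -> is_contact_order P1 P2 k ->
  let e : nat := ell_eq P1 P2 L k in
  let c := Cbar L R * cabs (mu P1 P2) ^+ (tbar L - taubar L)
           * A2 ^+ (taunbar L - taubar' L)
           * cabs (delta P1 P2 k) ^+ taubar' L in
  let N := (nu P2 * n_ L e + k.+1 * (tau L e - 1))%N in
  0 < c /\
  forall lam : {ffun idx L -> C}, lam != 0 ->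
  [/\ f_ P1 P2 lam != 0,
    (nzeros (f_ P1 P2 lam) (1 / 4))%:R <=
      5 * (nubar P1 P2 L e + k.+1 * (tau L e - 1))%:R * ln 2
      + 5 * ln (2 + 4 * X / (3 * c))
    & (nzeros (f_ P1 P2 lam) (3 / (4 * 8 ^+ N) * Num.min (2 / 3) (c / X)) <= N)%N].
Proof.
move=> nu_eq contact e c N.
have g1 := B1_le1 B1_eq1.
have wi := level_inj nu_eq contact lac.
have wN := @level_le_max R P1 P2 L k nu_eq.
have cE := cabs_level_minor P1_neq0 P2_neq0 nu_eq contact lac.
rewrite -/c in cE.
have N0 : (0 < N)%N by apply: (inj_bound_gt0 _ wi wN); rewrite card_idx.
have c0 : 0 < c.
  rewrite !mulr_gt0 ?exprn_gt0 ?cabs_gt0 ?mu_neq0 ?a0_neq0 ?(delta_neq0 contact) //.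
  exact: lt_le_trans ltr01 (Cbar_ge1 L R).
split=> // lam /ffun_neq0 l0.
have := @family_zeros R _ _ _ wi g1 N (4 * X / (3 * c)) lam N0 wN.
rewrite cE card_idx -f_E => /(_ c0).
have C0 : 0 <= 4 * X / (3 * c) by apply: divr_ge0; apply: mulr_ge0 => //; exact: ltW.
have C3 : m%:R ^+ 3 <= (4 * X / (3 * c) * c) ^+ 2.
  apply: le_trans (cube_le_halfpow R m2) _.
  have -> : 4 * X / (3 * c) * c = 4 / 3 * X by field; rewrite gt_eqF.
  by rewrite [leRHS]exprMn ler_peMl ?sqr_ge0 //; lra.
move=> /(_ C0 C3 l0)[f0 zq zr]; split=> //.
  by rewrite nubar_eq // -ltnS /e.
clearbody c N; have E8 : 0 < (8 : R) ^+ N by rewrite exprn_gt0.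
have r0 : 0 <= 3 / (4 * 8 ^+ N) :> R.
  by apply: divr_ge0 => //; apply: mulr_ge0 => //; exact: ltW.
have cX0 : 0 <= c / X by apply: divr_ge0; exact: ltW.
(* The two values of the minimum correspond to the constants 2 and [4 X / (3 c)]; the threshold 2/3
   is where they agree, so the larger one is always used. *)
have [cX|cX] := leP (2 / 3) (c / X).
  apply: (zr 2) => //.
  - rewrite ler_pdivrMr ?mulr_gt0 //.
    by move: cX; rewrite ler_pdivlMr //; lra.
  - lra.
  - have -> // : 3 / (4 * 8 ^+ N) * (2 / 3) = 1 / (8 ^+ N * 2) :> R.
    by field; rewrite gt_eqF.
apply: (zr (4 * X / (3 * c))) => //.
- rewrite ler_pdivlMr ?mulr_gt0 //.
  by move: cX; rewrite ltr_pdivrMr //; lra.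
- exact: mulr_ge0.
- have -> // : 3 / (4 * 8 ^+ N) * (c / X) = 1 / (8 ^+ N * (4 * X / (3 * c))).
  by field; rewrite !gt_eqF.
Qed.

Let d := lac_deg L.

(** [N + 1 <= 2 nu1 d m], all exponents are at most [d m], and [ln X <= 2 d m]. Absolute values are
    taken as the logarithms may have either sign. *)
Lemma growth_neq : (nu P2 <= nu P1)%N ->
  5 * (nutilde P1 P2 L (ell_neq P1 P2 L)).+1%:R * ln 2 + 5 / 2 * m.+1%:R * ln m%:R
      + 5 * (tbar L - m)%:R * ln (1 / A0)
      + 5 * (taunbar L - (tbar L - m))%:R * ln (1 / A2) <=
  (10 * (nu P1)%:R + 10 + 5 * `|ln (1 / A0)| + 5 * `|ln (1 / A2)|) * (d * m)%:R :> R.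
Proof.
move=> nu_le; set N := nutilde _ _ _ _.
have d1 : (0 < d)%N := lac_deg_gt0 m2.
have NN : N.+1%:R <= 2 * (nu P1)%:R * (d * m)%:R :> R.
  rewrite -[2]/(2%:R) -!natrM ler_nat.
  have : (N <= d * nu P1)%N.
    rewrite /N /nutilde; set l := nat_of_ord (ell_neq P1 P2 L).
    have ll : (l <= ld L)%N by rewrite -ltnS; exact: ltn_ord.
    have tl : ((tau L l).-1 < tau L l)%N by rewrite ltn_predL tau_gt0.
    have /andP[_ h] := t_range ll tl; have nl := n_le_deg ll.
    have {h} : (t_ L l (tau L l) - 1 <= n_ L l)%N by rewrite /t_ leq_subLR add1n; exact: h.
    move: (t_ L l (tau L l) - 1)%N => x xn.
    apply: leq_trans (_ : n_ L l * nu P1 <= _)%N; last by rewrite leq_mul2r nl orbT.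
    by move: nu_le; nia.
  by move: m2 nu_gt0 nu_le d1; nia.
have [h1 _] := mulrn_ln_le (1 / A0) (tbar_sub_le L).
have [h2 _] := mulrn_ln_le (1 / A2)
  (leq_trans (leq_subr (tbar L - m) _) (taunbar_le L)).
have h3 := ln_halfpow_le R m2; rewrite ln_halfpow in h3.
have h4 : N.+1%:R * ln 2 <= N.+1%:R * 1 :> R by rewrite ler_wpM2l // ln2_le1.
rewrite -/d in h1 h3 *; move: h1 h2 h3 h4 NN; set dm := (d * m)%:R.
lra.
Qed.

Lemma growth_eq : nu P1 = nu P2 -> is_contact_order P1 P2 k ->
  let e : nat := ell_eq P1 P2 L k in
  let c := Cbar L R * cabs (mu P1 P2) ^+ (tbar L - taubar L)
           * A2 ^+ (taunbar L - taubar' L)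
           * cabs (delta P1 P2 k) ^+ taubar' L in
  5 * (nubar P1 P2 L e + k.+1 * (tau L e - 1))%:R * ln 2
      + 5 * ln (2 + 4 * X / (3 * c)) <=
  (5 * (nu P2 + k.+1)%:R + 20 + 5 * `|ln (cabs (mu P1 P2))| + 5 * `|ln A2|
    + 5 * `|ln (cabs (delta P1 P2 k))|) * (d * m)%:R :> R.
Proof.
move=> nu_eq contact; cbv zeta.
set e := nat_of_ord (ell_eq P1 P2 L k); set c := Cbar L R * _ * _ * _.
have [c0 _] := zeros_eq nu_eq contact; rewrite -/c in c0.
have d1 : (0 < d)%N := lac_deg_gt0 m2.
have ll : (e <= ld L)%N by rewrite -ltnS; exact: ltn_ord.
have NN : (nubar P1 P2 L e + k.+1 * (tau L e - 1))%:R <= (nu P2 + k.+1)%:R * (d * m)%:R :> R.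
  rewrite -natrM ler_nat nubar_eq //.
  have nl := n_le_deg ll; have tl := tau_le ll; rewrite -/d in nl.
  have t1 : (tau L e - 1 <= n_ L e)%N by rewrite leq_subLR add1n.
  apply: leq_trans (_ : (nu P2 + k.+1) * d <= _)%N.
    by rewrite mulnDl leq_add // leq_mul2l ?nl ?(leq_trans t1 nl) orbT.
  by rewrite leq_mul2l -[X in (X <= _)%N]muln1 leq_mul2l ltnW ?orbT //; lia.
have mu0 : 0 < cabs (mu P1 P2) by rewrite cabs_gt0 mu_neq0.
have a20 : 0 < A2 by rewrite cabs_gt0 a0_neq0.
have de0 : 0 < cabs (delta P1 P2 k) by rewrite cabs_gt0 (delta_neq0 contact).
have C1 := Cbar_ge1 L R; have C0 : 0 < Cbar L R by apply: lt_le_trans C1.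
pose S := (d * m)%:R * `|ln (cabs (mu P1 P2))| + (d * m)%:R * `|ln A2|
  + (d * m)%:R * `|ln (cabs (delta P1 P2 k))| : R.
have S0 : 0 <= S by rewrite !addr_ge0 ?mulr_ge0.
have cS : - ln c <= S.
  rewrite /c !lnM ?posrE ?mulr_gt0 ?exprn_gt0 // !lnXn //.
  have [_ h1] := mulrn_ln_le (cabs (mu P1 P2)) (tbar_taubar_le L).
  have [_ h2] := mulrn_ln_le A2 (leq_trans (leq_subr (taubar' L) _) (taunbar_le L)).
  have [_ h3] := mulrn_ln_le (cabs (delta P1 P2 k)) (taubar'_le L).
  rewrite -[ln (cabs (mu P1 P2)) *+ _]mulr_natl -[ln A2 *+ _]mulr_natl.
  rewrite -[ln (cabs (delta P1 P2 k)) *+ _]mulr_natl.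
  (* [Cbar >= 1], so its logarithm only helps. *)
  have := ln_ge0 C1; rewrite /S; lra.
have X1 : 1 <= X by move: X2; lra.
have h := ln_dominated X1 c0 S0 cS.
have hX := ln_halfpow_le R m2; rewrite -/d in hX.
have dm1 : 1 <= (d * m)%:R :> R by rewrite ler1n muln_gt0 d1 ltnW.
have N2 : (nubar P1 P2 L e + k.+1 * (tau L e - 1))%:R * ln 2 <=
   (nubar P1 P2 L e + k.+1 * (tau L e - 1))%:R * 1 :> R by rewrite ler_wpM2l // ln2_le1.
move: h hX NN N2; rewrite /S => h hX NN N2.
(* The 20 is 5 (2 + 2): the constant 2 of [ln_dominated], absorbed using [d m >= 1], and the 2 of
   [ln X <= 2 d m]. *)
lra.
Qed.

End CaseBounds.

(** * Zero bounds for all lacunary families on a given curve *)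

Theorem theorem5p15 (R : realType) (P1 P2 : {poly R[i]}) (k : nat)
    (P1_neq0 : P1 != 0) (P2_neq0 : P2 != 0)
    (P_nonprop : forall c : R[i], P1 <> c *: P2)
    (P1_0 : root P1 0) (P2_0 : root P2 0)
    (nu_le : (1 <= nu P2 <= nu P1)%N)
    (k_contact : nu P1 = nu P2 -> is_contact_order P1 P2 k) :
  exists K : R, forall L : lacunary,
    (2 <= lac_dim L)%N -> B1 P1 P2 L = 1 -> lacunarity P1 P2 L k ->
    exists2 Z : nat, is_max_nzeros P1 P2 L (1 / 4) Z &
    (nu P1 <> nu P2 ->
      let N := nutilde P1 P2 L (ell_neq P1 P2 L) in
      let c := cabs (alpha_ P1 0) ^+ (tbar L - lac_dim L)
               * cabs (a_ P2 0) ^+ (taunbar L - (tbar L - lac_dim L)) in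
      Z%:R <= 5 * N.+1%:R * ln 2 + 5 / 2 * (lac_dim L).+1%:R * ln (lac_dim L)%:R
              + 5 * (tbar L - lac_dim L)%:R * ln (1 / cabs (alpha_ P1 0))
              + 5 * (taunbar L - (tbar L - lac_dim L))%:R * ln (1 / cabs (a_ P2 0))
           <= K * (lac_deg L * lac_dim L)%:R
      /\ forall lam : {ffun idx L -> R[i]}, lam != 0 ->
           at_most_zeros (f_ P1 P2 lam)
             (3 / (4 * 8 ^+ N) * (c / (lac_dim L)%:R `^ ((lac_dim L).+1%:R / 2))) N)
    /\
    (nu P1 = nu P2 ->
      let e : nat := ell_eq P1 P2 L k in
      let c := Cbar L R * cabs (mu P1 P2) ^+ (tbar L - taubar L)
               * cabs (a_ P2 0) ^+ (taunbar L - taubar' L)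
               * cabs (delta P1 P2 k) ^+ taubar' L in
      let N := (nu P2 * n_ L e + k.+1 * (tau L e - 1))%N in
      Z%:R <= 5 * (nubar P1 P2 L e + k.+1 * (tau L e - 1))%:R * ln 2
              + 5 * ln (2 + 4 * (lac_dim L)%:R `^ ((lac_dim L).+1%:R / 2) / (3 * c))
           <= K * (lac_deg L * lac_dim L)%:R
      /\ forall lam : {ffun idx L -> R[i]}, lam != 0 ->
           at_most_zeros (f_ P1 P2 lam)
             (3 / (4 * 8 ^+ N)
              * Num.min (2 / 3) (c / (lac_dim L)%:R `^ ((lac_dim L).+1%:R / 2)))
             N).
Proof.
have /andP[nu_gt0 nu_le12] := nu_le.
(* The constants behind O(dm) depend on [P1], [P2] and [k] alone, so they are fixed before the
   family [L]. *)
pose K1 : R := 10 * (nu P1)%:R + 10 + 5 * `|ln (1 / cabs (alpha_ P1 0))|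
  + 5 * `|ln (1 / cabs (a_ P2 0))|.
pose K2 : R := 5 * (nu P2 + k.+1)%:R + 20 + 5 * `|ln (cabs (mu P1 P2))|
  + 5 * `|ln (cabs (a_ P2 0))| + 5 * `|ln (cabs (delta P1 P2 k))|.
have [nu_eq|nu_neq] := eqVneq (nu P1) (nu P2).
  exists K2 => L m2 B11 lac; have contact := k_contact nu_eq.
  have [_ H] := zeros_eq P1_neq0 P2_neq0 m2 B11 lac nu_eq contact.
  have [] := @max_nzeros R P1 P2 L (1 / 4)
    (5 * (nubar P1 P2 L (ell_eq P1 P2 L k) + k.+1 * (tau L (ell_eq P1 P2 L k) - 1))%:R * ln 2
      + 5 * ln (2 + 4 * halfpow R (lac_dim L) / (3 * (Cbar L R * cabs (mu P1 P2) ^+ (tbar L - taubar L)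
               * cabs (a_ P2 0) ^+ (taunbar L - taubar' L)
               * cabs (delta P1 P2 k) ^+ taubar' L)))).
  - by apply: exists_f_neq0 => // lam /H[].
  - by move=> lam /lam_neq0/H[].
  move=> Z Zmax Zle; exists Z => //; split=> // _; split.
    apply/andP; split; first exact: Zle.
    exact: (growth_eq P1_neq0 P2_neq0 m2 B11 lac nu_eq contact).
  by move=> lam /H[f0 _ z]; split.
exists K1 => L m2 B11 lac; move/eqP: nu_neq => nu_neq.
have H := zeros_neq P1_neq0 P2_neq0 m2 B11 lac nu_le12 nu_neq.
have [] := @max_nzeros R P1 P2 L (1 / 4)
  (5 * (nutilde P1 P2 L (ell_neq P1 P2 L)).+1%:R * ln 2 + 5 / 2 * (lac_dim L).+1%:R * ln (lac_dim L)%:R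
              + 5 * (tbar L - lac_dim L)%:R * ln (1 / cabs (alpha_ P1 0))
              + 5 * (taunbar L - (tbar L - lac_dim L))%:R * ln (1 / cabs (a_ P2 0))).
- by apply: exists_f_neq0 => // lam /H[].
- by move=> lam /lam_neq0/H[].
move=> Z Zmax Zle; exists Z => //; split=> // _; split.
  apply/andP; split; first exact: Zle.
  exact: (growth_neq P1_neq0 P2_neq0 nu_gt0 m2 nu_le12).
by move=> lam /H[f0 _ z]; split.
Qed.
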